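(* Let $\mathcal S$ be the system $$u_t+uu_x+v_x=0,\qquad v_t+uv_x+u_x=0,\qquad w_t+uw_x=0$$ for unknown functions $u,v,w$ of $(t,x)$. Any solution of $\mathcal S$ (locally) belongs to one of the following families, where $W$ is an arbitrary function of its argument. 1. The regular family, where $u_tv_x-u_xv_t\neq0$ (the general solution): $$t=\Phi_u,\quad x=u\Phi_u-\Phi_v-\Phi,\quad w=W(e^v\Phi_v).$$ Here the function $\Phi=\Phi(u,v)$ runs through the solutions of the telegraph equation $\Phi_{vv}+\Phi_v=\Phi_{uu}$ with $\Phi_{uu}\neq\Phi_{uv}$. 2. The singular family, where $u_tv_x-u_xv_t=0$ but $u$ and $v$ are not constants: $$x-(u+\varepsilon)t=e^{-\varepsilon u}\Theta_u,\quad v=\varepsilon u+c,\quad w=W(e^{\varepsilon u}t+\varepsilon\Theta_u-\Theta).$$ Here $c$ is an arbitrary constant, $\varepsilon=\pm1$, and $\Theta=\Theta(u)$ is an arbitrary function of $u$. 3. The ultra-singular family, where $u$ and $v$ are arbitrary constants and $w=W(x-ut)$.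
   Context: All functions are smooth and the considerations are local. The formulas in families 1 and 2 are implicit representations of solutions: $(u,v)$ (respectively $u$) is determined as a function of $(t,x)$ by the displayed relations between $t$, $x$, $u$, $v$. Subscripts denote partial derivatives.
   Formalization: ''Locally'' means near each point of a dense open set: where the Jacobian is nonzero; where it vanishes nearby and u, v have some nonzero first derivative at the point; or where u, v are locally constant. At other points, e.g. v=u, u(0,x)=x^2 at the origin, no family applies. *)

(* Defs.v *)
(* Stdlib real numbers with Coquelicot. *)
From Stdlib Require Export Reals.
From Coquelicot Require Export Coquelicot.

Open Scope R_scope.

(* Functions of two variables are curried and total; they are only constrained
   on an open subset of R * R, the domain under consideration. *)

(* C^infinity on [D], meaningful for open [D]: [ex_diff_n f n] asserts that all
   iterated partial derivatives of [f] up to order [n] exist and are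
   continuous. *)
Definition smooth2 (D : R * R -> Prop) (f : R -> R -> R) : Prop :=
  forall (n : nat) (x y : R), D (x, y) -> ex_diff_n f n x y.

Definition smooth1 (I : R -> Prop) (f : R -> R) : Prop :=
  forall (n : nat) (x : R), I x -> ex_derive_n f n x.

(* Derivatives in the first and in the second variable. *)
Notation d1 := (partial_derive 1 0).
Notation d2 := (partial_derive 0 1).

Definition solution (D : R * R -> Prop) (u v w : R -> R -> R) : Prop :=
  smooth2 D u /\ smooth2 D v /\ smooth2 D w /\
  forall t x : R, D (t, x) ->
    d1 u t x + u t x * d2 u t x + d2 v t x = 0 /\
    d1 v t x + u t x * d2 v t x + d2 u t x = 0 /\
    d1 w t x + u t x * d2 w t x = 0.

Definition jac (u v : R -> R -> R) (t x : R) : R :=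
  d1 u t x * d2 v t x - d2 u t x * d1 v t x.

Definition regular_at (u v : R -> R -> R) (t x : R) : Prop :=
  jac u v t x <> 0.

(* "Not constant" is taken infinitesimally at the point: some first derivative
   of u or v is nonzero.  At a point where all of them vanish, x - (u + eps) t
   cannot be a differentiable function of u. *)
Definition singular_at (u v : R -> R -> R) (t x : R) : Prop :=
  locally_2d (fun t' x' => jac u v t' x' = 0) t x /\
  ~ (d1 u t x = 0 /\ d2 u t x = 0 /\ d1 v t x = 0 /\ d2 v t x = 0).

Definition ultra_singular_at (u v : R -> R -> R) (t x : R) : Prop :=
  locally_2d (fun t' x' => u t' x' = u t x /\ v t' x' = v t x) t x.

(* In the first two families the equivalence says that the displayed relations
   hold and determine the values (u, v), respectively u, as functions of (t, x)
   within the domain [G] of Phi, respectively [J] of Theta. *)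
Definition regular_family (N : R * R -> Prop) (u v w : R -> R -> R) : Prop :=
  exists (G : R * R -> Prop) (Phi : R -> R -> R) (I : R -> Prop) (W : R -> R),
    open G /\ smooth2 G Phi /\ open I /\ smooth1 I W /\
    (forall a b : R, G (a, b) ->
       partial_derive 0 2 Phi a b + d2 Phi a b = partial_derive 2 0 Phi a b /\
       partial_derive 2 0 Phi a b <> partial_derive 1 1 Phi a b) /\
    forall t x : R, N (t, x) ->
      G (u t x, v t x) /\
      (forall a b : R, G (a, b) ->
         (a = u t x /\ b = v t x <->
          t = d1 Phi a b /\ x = a * d1 Phi a b - d2 Phi a b - Phi a b)) /\
      I (exp (v t x) * d2 Phi (u t x) (v t x)) /\
      w t x = W (exp (v t x) * d2 Phi (u t x) (v t x)).

Definition singular_family (N : R * R -> Prop) (u v w : R -> R -> R) : Prop :=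
  exists (eps c : R) (J : R -> Prop) (Theta : R -> R)
         (I : R -> Prop) (W : R -> R),
    (eps = 1 \/ eps = -1) /\
    open J /\ smooth1 J Theta /\ open I /\ smooth1 I W /\
    forall t x : R, N (t, x) ->
      J (u t x) /\
      (forall a : R, J a ->
         (a = u t x <->
          x - (a + eps) * t = exp (- eps * a) * Derive Theta a)) /\
      v t x = eps * u t x + c /\
      let omega := exp (eps * u t x) * t + eps * Derive Theta (u t x)
                   - Theta (u t x) in
      I omega /\ w t x = W omega.

Definition ultra_singular_family
    (N : R * R -> Prop) (u v w : R -> R -> R) : Prop :=
  exists (a b : R) (I : R -> Prop) (W : R -> R),
    open I /\ smooth1 I W /\
    forall t x : R, N (t, x) ->
      u t x = a /\ v t x = b /\ I (x - a * t) /\ w t x = W (x - a * t).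

Definition belongs_near (F : (R * R -> Prop) -> Prop)
    (D : R * R -> Prop) (t x : R) : Prop :=
  exists N : R * R -> Prop,
    open N /\ N (t, x) /\ (forall p, N p -> D p) /\ F N.

(* Main.v *)
Require Import Defs.
From Stdlib Require Import Lra ClassicalEpsilon.

(** Along a solution the Jacobian of [(u, v)] equals [u_x^2 - v_x^2].

    Where it does not vanish, the inverse function theorem makes [(t, x)] a
    function [(T, X)] of [(a, b) = (u, v)], and the system becomes linear:
    [T_b = a T_a - X_a] and [X_b = a T_b - T_a].  The first equation says that
    [exp b * (T da + (a T - X) db)] is closed; its potential divided by [exp b]
    is [Phi], and the second equation is the telegraph equation.  Where the
    Jacobian vanishes but the gradient does not, [v_x = eps u_x] near the point,
    so [v - eps u] is constant and [x - (u + eps) t] is a function of [u].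

    In each regime the argument [omega] of [W] satisfies
    [omega_t + u omega_x = 0] with [omega_x <> 0].  Since [w] satisfies the same
    equation, [w] and [omega] have zero Jacobian, so [w = W(omega)]. *)

(** [exp b] is an integrating factor: the formula for x contains [Phi] undifferentiated, so it
    prescribes Phi_b + Phi rather than Phi_b, and exp b * (Phi_b + Phi) is the b-derivative of exp b
    * Phi. The condition Phi_uu <> Phi_uv reads T_a <> T_b; it holds because the determinant T_a X_b
    - T_b X_a equals T_b^2 - T_a^2.

    The analytic obstacle is that every constructed object (inverse, potential, [Theta], [W]) must
    be smooth to all orders. Formulas for higher derivatives are avoided by coinduction: it suffices
    to exhibit a class of functions stable under differentiation. Only a scalar implicit function
    theorem is proved from scratch; the inverse function theorem is two uses of it, and w = W(omega)
    is one. The inverses live on full boxes, where closed forms can be integrated along the axes and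
    where uniqueness in the implicit representations can be stated.

    A solution may change regime, and at a boundary point none of the three need apply; hence the
    density statement. *)

Notation DL := differentiable_pt_lim.

(** * Total derivatives of functions of two variables *)

Lemma open_2d (D : R * R -> Prop) :
  open D <-> forall x y, D (x, y) -> locally_2d (fun u v => D (u, v)) x y.
Proof.
split.
- intros H x y Hxy; apply locally_2d_locally.
  generalize (H _ Hxy); apply filter_imp; now intros [a b].
- intros H [x y] Hxy; generalize (proj1 (locally_2d_locally _ _ _) (H x y Hxy)).
  apply filter_imp; now intros [a b].
Qed.

Lemma locally_2d_open (D : R * R -> Prop) x y :
  open D -> D (x, y) -> locally_2d (fun u v => D (u, v)) x y.
Proof. intros H; now apply open_2d. Qed.

Lemma DL_ext_open (D : R * R -> Prop) f g x y a b :
  open D -> D (x, y) -> (forall u v, D (u, v) -> f u v = g u v) ->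
  DL f x y a b -> DL g x y a b.
Proof.
intros oD Dxy E; apply differentiable_pt_lim_ext.
apply locally_2d_impl with (2 := locally_2d_open D x y oD Dxy).
now apply locally_2d_forall.
Qed.

Lemma DL_eq f x y a b a' b' : DL f x y a b -> a = a' -> b = b' -> DL f x y a' b'.
Proof. now intros H <- <-. Qed.

Lemma DL_cont f x y a b : DL f x y a b -> continuity_2d_pt f x y.
Proof. intros H; apply differentiable_continuity_pt; now exists a, b. Qed.

Lemma DL_d f x y a b : DL f x y a b -> d1 f x y = a /\ d2 f x y = b.
Proof. apply differentiable_pt_lim_unique. Qed.

Lemma DL_unique f x y a b a' b' : DL f x y a b -> DL f x y a' b' -> a = a' /\ b = b'.
Proof.
intros H H'; destruct (DL_d _ _ _ _ _ H), (DL_d _ _ _ _ _ H'); split; congruence.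
Qed.

(** [W] is regarded as a function of two variables that ignores the second, and [f] is fed into both
    slots of the two-variable chain rule. *)
Lemma DL_comp1 (W : R -> R) l f x y a b :
  is_derive W (f x y) l -> DL f x y a b ->
  DL (fun u v => W (f u v)) x y (l * a) (l * b).
Proof.
intros HW Hf.
apply DL_eq with (l * a + 0 * a) (l * b + 0 * b); try ring.
apply (differentiable_pt_lim_comp (fun u _ => W u) f f); try assumption.
apply differentiable_pt_lim_proj1_0; now apply is_derive_Reals.
Qed.

Lemma DL_const c x y : DL (fun _ _ => c) x y 0 0.
Proof.
apply (differentiable_pt_lim_proj1_0 (fun _ => c)), is_derive_Reals.
apply (is_derive_const c x).
Qed.

Lemma DL_fst x y : DL (fun u _ => u) x y 1 0.
Proof.
apply (differentiable_pt_lim_proj1_0 (fun u => u)), is_derive_Reals.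
apply (is_derive_id x).
Qed.

Lemma DL_snd x y : DL (fun _ v => v) x y 0 1.
Proof.
intros eps; apply locally_2d_forall; intros u v.
replace (v - y - (0 * (u - x) + 1 * (v - y))) with 0 by ring.
rewrite Rabs_R0; apply Rmult_le_pos; [left; apply cond_pos|].
apply Rle_trans with (Rabs (u - x)); [apply Rabs_pos | apply Rmax_l].
Qed.

Lemma DL_lin p q x y : DL (fun u v => p * u + q * v) x y p q.
Proof.
intros eps; apply locally_2d_forall; intros u v.
replace (_ - _) with 0 by ring.
rewrite Rabs_R0; apply Rmult_le_pos; [left; apply cond_pos|].
apply Rle_trans with (Rabs (u - x)); [apply Rabs_pos | apply Rmax_l].
Qed.

Lemma DL_plus f g x y a b c d : DL f x y a b -> DL g x y c d ->
  DL (fun u v => f u v + g u v) x y (a + c) (b + d).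
Proof.
intros Hf Hg.
generalize (differentiable_pt_lim_comp _ _ _ _ _ _ _ _ _ _ _ (DL_lin 1 1 _ _) Hf Hg).
intros H; eapply DL_eq; [eapply differentiable_pt_lim_ext, H | ring | ring].
apply locally_2d_forall; intros u v; ring.
Qed.

Lemma DL_opp f x y a b : DL f x y a b -> DL (fun u v => - f u v) x y (- a) (- b).
Proof.
intros Hf; eapply DL_eq; [apply (DL_comp1 Ropp (-1)), Hf | ring | ring].
apply (is_derive_opp (fun x => x) _ 1), (is_derive_id (f x y)).
Qed.

Lemma DL_minus f g x y a b c d : DL f x y a b -> DL g x y c d ->
  DL (fun u v => f u v - g u v) x y (a - c) (b - d).
Proof. intros Hf Hg; apply DL_plus; [assumption | now apply DL_opp]. Qed.

(* Polarization reduces the product rule to the one-variable square. *)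
Lemma DL_mult f g x y a b c d : DL f x y a b -> DL g x y c d ->
  DL (fun u v => f u v * g u v) x y (a * g x y + f x y * c) (b * g x y + f x y * d).
Proof.
assert (S : forall h p q, DL h x y p q -> DL (fun u v => (h u v)^2 / 4) x y
   (h x y / 2 * p) (h x y / 2 * q)).
{ intros h p q; apply (DL_comp1 (fun z => z^2 / 4)).
  auto_derive; [exact I | field]. }
intros Hf Hg.
generalize (DL_minus _ _ _ _ _ _ _ _ (S _ _ _ (DL_plus _ _ _ _ _ _ _ _ Hf Hg))
  (S _ _ _ (DL_minus _ _ _ _ _ _ _ _ Hf Hg))).
intros H; eapply DL_eq; [eapply differentiable_pt_lim_ext, H | cbv beta; field | cbv beta; field].
apply locally_2d_forall; intros u v; field.
Qed.

Lemma DL_is_derive f x y a b : DL f x y a b ->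
  is_derive (fun z => f z y) x a /\ is_derive (fun z => f x z) y b.
Proof.
intros H; split; apply is_derive_Reals.
- replace a with (a * 1 + b * 0) by ring.
  apply (derivable_pt_lim_comp_2d f (fun z => z) (fun _ => y)); [exact H | |];
   apply is_derive_Reals; [apply (is_derive_id x) | apply (is_derive_const y x)].
- replace b with (a * 0 + b * 1) by ring.
  apply (derivable_pt_lim_comp_2d f (fun _ => x) (fun z => z)); [exact H | |];
   apply is_derive_Reals; [apply (is_derive_const x y) | apply (is_derive_id y)].
Qed.

Lemma DL_swap f x y a b : DL f x y a b -> DL (fun v u => f u v) y x b a.
Proof.
intros H eps; destruct (H eps) as [d Hd]; exists d; intros u v Hu Hv.
rewrite Rmax_comm, (Rplus_comm (b * _)); now apply Hd.
Qed.

(** Continuity of one partial derivative is enough for total differentiability; the other only has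
    to exist at the point itself. *)
Lemma DL_of_C1 (D : R * R -> Prop) f g h x y :
  open D -> D (x, y) ->
  (forall u v, D (u, v) -> is_derive (fun z => f z v) u (g u v)) ->
  is_derive (fun z => f x z) y (h x y) ->
  continuity_2d_pt g x y -> DL f x y (g x y) (h x y).
Proof.
intros oD Dxy H1 H2 Hg; apply filterdiff_differentiable_pt_lim.
apply (is_derive_filterdiff f x y g (h x y)).
- generalize (oD _ Dxy); apply filter_imp; intros [u v]; apply H1.
- exact H2.
- now apply continuity_2d_pt_filterlim in Hg.
Qed.

(** * Closure properties of smooth functions *)

Lemma smooth2_cont D f x y : smooth2 D f -> D (x, y) -> continuity_2d_pt f x y.
Proof. intros H Hp; exact (proj1 (H 0%nat x y Hp)). Qed.

Lemma smooth2_d1 D f : smooth2 D f -> smooth2 D (d1 f).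
Proof. intros H n x y Hp; apply (H (S n) x y Hp). Qed.

Lemma smooth2_d2 D f : smooth2 D f -> smooth2 D (d2 f).
Proof. intros H n x y Hp; apply (H (S n) x y Hp). Qed.

Lemma smooth2_is_derive D f x y : smooth2 D f -> D (x, y) ->
  is_derive (fun z => f z y) x (d1 f x y) /\ is_derive (fun z => f x z) y (d2 f x y).
Proof.
intros H Hp; destruct (H 1%nat x y Hp) as [_ [H1 [H2 _]]].
split; now apply Derive_correct.
Qed.

Lemma smooth2_DL D f x y : open D -> smooth2 D f -> D (x, y) ->
  DL f x y (d1 f x y) (d2 f x y).
Proof.
intros oD H Hp; apply (DL_of_C1 D); try assumption.
- intros u v Huv; now apply (smooth2_is_derive D).
- now apply (smooth2_is_derive D).
- apply (smooth2_cont D); [now apply smooth2_d1 | assumption].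
Qed.

Lemma smooth2_sub (D E : R * R -> Prop) f :
  (forall p, E p -> D p) -> smooth2 D f -> smooth2 E f.
Proof. intros H Hf n x y Hp; apply Hf; auto. Qed.

Lemma smooth2_Schwarz D f x y : open D -> smooth2 D f -> D (x, y) ->
  d2 (d1 f) x y = d1 (d2 f) x y.
Proof.
intros oD H Hp; symmetry; apply Schwarz.
- apply locally_2d_impl with (2 := locally_2d_open D x y oD Hp).
  apply locally_2d_forall; intros u v Huv.
  destruct (H 2%nat u v Huv) as (_ & A & B & (_ & _ & C & _) & (_ & E & _)); tauto.
- apply (smooth2_cont D); [apply smooth2_d1, smooth2_d2, H | assumption].
- apply (smooth2_cont D); [apply smooth2_d2, smooth2_d1, H | assumption].
Qed.

(** Coinduction for smoothness: if each member of [P] has a gradient whose components are again in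
    [P], derivatives can be taken indefinitely. All later smoothness proofs rest on a suitable
    choice of [P]. *)
Lemma smooth2_coind (D : R * R -> Prop) (P : (R -> R -> R) -> Prop) :
  open D ->
  (forall f, P f -> exists g h, P g /\ P h /\
     forall x y, D (x, y) -> DL f x y (g x y) (h x y)) ->
  forall f, P f -> smooth2 D f.
Proof.
intros oD HP f Pf n; revert f Pf; induction n as [|n IH]; intros f Pf x y Hp;
  destruct (HP f Pf) as (g & h & Pg & Ph & Hd).
- split; [apply (DL_cont _ _ _ _ _ (Hd x y Hp)) | exact I].
- destruct (DL_is_derive _ _ _ _ _ (Hd x y Hp)) as [H1 H2].
  assert (L := locally_2d_open D x y oD Hp).
  repeat split.
  + apply (DL_cont _ _ _ _ _ (Hd x y Hp)).
  + now exists (g x y).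
  + now exists (h x y).
  + apply ex_diff_n_ext_loc with g; [| now apply IH].
    apply locally_2d_impl with (2 := L), locally_2d_forall; intros u v Huv.
    symmetry; apply (DL_d _ _ _ _ _ (Hd u v Huv)).
  + apply ex_diff_n_ext_loc with h; [| now apply IH].
    apply locally_2d_impl with (2 := L), locally_2d_forall; intros u v Huv.
    symmetry; apply (DL_d _ _ _ _ _ (Hd u v Huv)).
Qed.

(** For functions known through their gradient, such as primitives and potentials. *)
Lemma smooth2_of_DL (D : R * R -> Prop) f g h :
  open D -> smooth2 D g -> smooth2 D h ->
  (forall x y, D (x, y) -> DL f x y (g x y) (h x y)) -> smooth2 D f.
Proof.
intros oD Hg Hh Hf.
apply (smooth2_coind D (fun k => k = f \/ smooth2 D k)); [assumption | | now left].
intros k [-> | Hk].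
- exists g, h; auto.
- exists (d1 k), (d2 k); repeat split.
  + right; now apply smooth2_d1.
  + right; now apply smooth2_d2.
  + intros x y Hp; now apply (smooth2_DL D).
Qed.

Lemma smooth2_ext (D : R * R -> Prop) f g :
  open D -> (forall x y, D (x, y) -> f x y = g x y) -> smooth2 D f -> smooth2 D g.
Proof.
intros oD E Hf; apply smooth2_of_DL with (d1 f) (d2 f);
  [assumption | now apply smooth2_d1 | now apply smooth2_d2 |].
intros x y Hp; apply (DL_ext_open D f); try assumption.
now apply (smooth2_DL D).
Qed.

(** The derivative of a product is a sum of products, and that of a composite involves both
    operations, so no single operation gives a class stable under differentiation. Closing under all
    three at once does. *)
Inductive smooth_term (D : R * R -> Prop) : (R -> R -> R) -> Prop :=
| st_base f : smooth2 D f -> smooth_term D f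
| st_plus f g : smooth_term D f -> smooth_term D g ->
    smooth_term D (fun x y => f x y + g x y)
| st_mult f g : smooth_term D f -> smooth_term D g ->
    smooth_term D (fun x y => f x y * g x y)
| st_comp (E : R * R -> Prop) F f g : open E -> smooth2 E F ->
    (forall x y, D (x, y) -> E (f x y, g x y)) ->
    smooth_term D f -> smooth_term D g ->
    smooth_term D (fun x y => F (f x y) (g x y)).

Lemma smooth2_term D f : open D -> smooth_term D f -> smooth2 D f.
Proof.
intros oD; apply smooth2_coind; [assumption | clear f].
intros f Hf; induction Hf as
 [f Hf | f g Hf (f1 & f2 & Hf1 & Hf2 & Df) Hg (g1 & g2 & Hg1 & Hg2 & Dg)
 | f g Hf (f1 & f2 & Hf1 & Hf2 & Df) Hg (g1 & g2 & Hg1 & Hg2 & Dg)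
 | E F f g oE HF HE Hf (f1 & f2 & Hf1 & Hf2 & Df) Hg (g1 & g2 & Hg1 & Hg2 & Dg)].
- exists (d1 f), (d2 f); repeat split.
  + apply st_base, smooth2_d1, Hf.
  + apply st_base, smooth2_d2, Hf.
  + intros x y Hp; now apply (smooth2_DL D).
- exists (fun x y => f1 x y + g1 x y), (fun x y => f2 x y + g2 x y).
  split; [now apply st_plus | split; [now apply st_plus |]].
  intros x y Hp; apply DL_plus; auto.
- exists (fun x y => f1 x y * g x y + f x y * g1 x y),
    (fun x y => f2 x y * g x y + f x y * g2 x y).
  split; [apply st_plus; now apply st_mult | split; [apply st_plus; now apply st_mult |]].
  intros x y Hp; apply DL_mult; auto.
- exists (fun x y => d1 F (f x y) (g x y) * f1 x y + d2 F (f x y) (g x y) * g1 x y),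
    (fun x y => d1 F (f x y) (g x y) * f2 x y + d2 F (f x y) (g x y) * g2 x y).
  assert (smooth_term D (fun x y => d1 F (f x y) (g x y))).
  { apply st_comp with E; auto using smooth2_d1. }
  assert (smooth_term D (fun x y => d2 F (f x y) (g x y))).
  { apply st_comp with E; auto using smooth2_d2. }
  split; [apply st_plus; now apply st_mult | split; [apply st_plus; now apply st_mult |]].
  intros x y Hp; apply differentiable_pt_lim_comp; auto.
  apply (smooth2_DL E); auto.
Qed.

Lemma smooth2_plus D f g : open D -> smooth2 D f -> smooth2 D g ->
  smooth2 D (fun x y => f x y + g x y).
Proof. intros; apply smooth2_term; [assumption |]; apply st_plus; now apply st_base. Qed.

Lemma smooth2_mult D f g : open D -> smooth2 D f -> smooth2 D g ->
  smooth2 D (fun x y => f x y * g x y).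
Proof. intros; apply smooth2_term; [assumption |]; apply st_mult; now apply st_base. Qed.

Lemma smooth2_comp D (E : R * R -> Prop) F f g : open D -> open E -> smooth2 E F ->
  smooth2 D f -> smooth2 D g -> (forall x y, D (x, y) -> E (f x y, g x y)) ->
  smooth2 D (fun x y => F (f x y) (g x y)).
Proof.
intros; apply smooth2_term; [assumption |].
apply st_comp with E; try assumption; now apply st_base.
Qed.

Lemma smooth2_const D c : open D -> smooth2 D (fun _ _ => c).
Proof.
intros oD; apply (smooth2_coind D (fun f => exists c, f = fun _ _ => c)).
- assumption.
- intros f [k ->]; exists (fun _ _ => 0), (fun _ _ => 0).
  repeat split; [now exists 0 | now exists 0 | intros; apply DL_const].
- now exists c.
Qed.

Lemma smooth2_fst D : open D -> smooth2 D (fun x _ => x).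
Proof.
intros oD; apply smooth2_of_DL with (fun _ _ => 1) (fun _ _ => 0);
 auto using smooth2_const, DL_fst.
Qed.

Lemma smooth2_snd D : open D -> smooth2 D (fun _ y => y).
Proof.
intros oD; apply smooth2_of_DL with (fun _ _ => 0) (fun _ _ => 1);
 auto using smooth2_const, DL_snd.
Qed.

Lemma smooth2_opp D f : open D -> smooth2 D f -> smooth2 D (fun x y => - f x y).
Proof.
intros oD Hf; apply (smooth2_ext D (fun x y => -1 * f x y)); [assumption | intros; ring |].
apply smooth2_mult; auto using smooth2_const.
Qed.

Lemma smooth2_minus D f g : open D -> smooth2 D f -> smooth2 D g ->
  smooth2 D (fun x y => f x y - g x y).
Proof.
intros oD Hf Hg; apply smooth2_plus; [assumption | assumption | now apply smooth2_opp].
Qed.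

Lemma open_strip (I : R -> Prop) : open I -> open (fun p : R * R => I (fst p)).
Proof.
intros oI; apply (open_comp (fun p : R * R => fst p)); [| assumption].
intros [x y] _; apply (continuous_fst x y).
Qed.

(** A function of one variable is made a function of two, constant in the second, so that the
    two-variable closure lemmas apply. The stable class consists of the iterated derivatives of [W]
    and of zero, the latter for the second partial derivative. *)
Lemma smooth1_strip (I : R -> Prop) W :
  open I -> smooth1 I W -> smooth2 (fun p => I (fst p)) (fun x _ => W x).
Proof.
intros oI HW.
apply (smooth2_coind _ (fun f => f = (fun _ _ => 0) \/
   exists n, f = fun x _ => Derive_n W n x)).
- now apply open_strip.
- intros f [-> | [n ->]].
  + exists (fun _ _ => 0), (fun _ _ => 0); repeat split; auto using DL_const.
  + exists (fun x _ => Derive_n W (S n) x), (fun _ _ => 0); repeat split.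
    * right; now exists (S n).
    * now left.
    * intros x y Hx; apply (differentiable_pt_lim_proj1_0 (Derive_n W n)).
      apply is_derive_Reals, Derive_correct, (HW (S n) x Hx).
- right; now exists 0%nat.
Qed.

Lemma smooth2_slice1 (D : R * R -> Prop) (I : R -> Prop) f y :
  open I -> (forall x, I x -> D (x, y)) -> smooth2 D f -> smooth1 I (fun x => f x y).
Proof.
intros oI HI Hf.
assert (H : forall n, smooth2 D (fun x y => Derive_n (fun z => f z y) n x)).
{ induction n as [|n IH]; [exact Hf | exact (smooth2_d1 _ _ IH)]. }
intros [|n] x Ix; [exact Logic.I |].
exact (proj1 (proj2 (H n 1%nat x y (HI x Ix)))).
Qed.

(** Exchanging the variables lets results proved where the x-derivative is nonzero serve where only
    the t-derivative is. *)
Lemma open_swap (D : R * R -> Prop) : open D -> open (fun p : R * R => D (snd p, fst p)).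
Proof.
intros oD; apply open_2d; intros x y Hp; destruct (locally_2d_open _ _ _ oD Hp) as [d Hd].
exists d; intros u v Hu Hv; now apply Hd.
Qed.

Lemma smooth2_swap D f : open D -> smooth2 D f ->
  smooth2 (fun p => D (snd p, fst p)) (fun y x => f x y).
Proof.
intros oD Hf.
assert (oD' := open_swap D oD).
apply (smooth2_comp _ D f (fun _ x => x) (fun y _ => y));
  auto using smooth2_fst, smooth2_snd.
Qed.

Lemma smooth2_slice2 (D : R * R -> Prop) (I : R -> Prop) f x :
  open D -> open I -> (forall y, I y -> D (x, y)) -> smooth2 D f ->
  smooth1 I (fun y => f x y).
Proof.
intros oD oI HI Hf.
apply (smooth2_slice1 (fun p => D (snd p, fst p)) I (fun y x => f x y));
 auto using smooth2_swap.
Qed.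

Lemma smooth2_comp1 D (I : R -> Prop) W f : open D -> open I -> smooth1 I W ->
  smooth2 D f -> (forall x y, D (x, y) -> I (f x y)) ->
  smooth2 D (fun x y => W (f x y)).
Proof.
intros oD oI HW Hf HI.
apply (smooth2_comp D (fun p => I (fst p)) (fun x _ => W x) f f);
  auto using open_strip, smooth1_strip.
Qed.

Lemma smooth1_exp I : smooth1 I exp.
Proof.
assert (H : forall n x, Derive_n exp n x = exp x).
{ induction n as [|n IH]; intros x; [reflexivity |].
  simpl; rewrite (Derive_ext _ exp _ IH); apply is_derive_unique, is_derive_exp. }
intros [|n] x _; [exact Logic.I |].
apply ex_derive_ext with exp; [intros; symmetry; apply H |].
exists (exp x); apply is_derive_exp.
Qed.

Lemma smooth2_exp D f : open D -> smooth2 D f -> smooth2 D (fun x y => exp (f x y)).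
Proof.
intros oD Hf; apply (smooth2_comp1 D (fun _ => True)); auto using smooth1_exp.
apply open_true.
Qed.

(** The functions p / f^n with smooth p and natural n are stable under differentiation: the gradient
    of p / f^n is (f grad p - n p grad f) / f^(n+1). *)
Lemma smooth2_inv D f : open D -> smooth2 D f ->
  (forall x y, D (x, y) -> f x y <> 0) -> smooth2 D (fun x y => / f x y).
Proof.
intros oD Hf Hn.
apply (smooth2_ext D (fun x y => 1 * (/ f x y) ^ 1)); [assumption | intros; ring |].
apply (smooth2_coind D (fun g => exists p n, smooth2 D p /\
  g = fun x y => p x y * (/ f x y) ^ n)).
- assumption.
- intros g (p & n & Hp & ->).
  exists (fun x y => (d1 p x y * f x y - INR n * p x y * d1 f x y) * (/ f x y) ^ S n),
    (fun x y => (d2 p x y * f x y - INR n * p x y * d2 f x y) * (/ f x y) ^ S n).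
  split; [| split].
  + eexists _, (S n); split; [| reflexivity].
    apply smooth2_minus; repeat apply smooth2_mult;
      auto using smooth2_const, smooth2_d1.
  + eexists _, (S n); split; [| reflexivity].
    apply smooth2_minus; repeat apply smooth2_mult;
      auto using smooth2_const, smooth2_d2.
  + intros x y Hxy.
    assert (HI : is_derive (fun z => (/ z) ^ n) (f x y)
                   (- INR n * (/ f x y) ^ S n)).
    { evar_last. apply (is_derive_pow _ n), is_derive_inv; [apply is_derive_id|].
      now apply Hn. 
      (* The power rule uses the exponent [pred n]; for n = 0 the factor [INR n] makes the term
         vanish. *)
      unfold one; simpl. destruct n as [|n]; [simpl; unfold Rdiv; ring |].
      change (pred (S n)) with n. simpl pow. field. now apply Hn. }
    eapply DL_eq; [apply DL_mult; [apply (smooth2_DL D); assumption |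
       apply (DL_comp1 (fun z => (/ z) ^ n) _ f x y (d1 f x y) (d2 f x y) HI); apply (smooth2_DL D); assumption] | |];
    simpl; field; now apply Hn.
- exists (fun _ _ => 1), 1%nat; split; [now apply smooth2_const | reflexivity].
Qed.

(** * Boxes, and the implicit function theorem for one scalar equation *)

Definition box (x y r : R) (p : R * R) : Prop :=
  Rabs (fst p - x) < r /\ Rabs (snd p - y) < r.

Lemma open_interval x r : open (fun z => Rabs (z - x) < r).
Proof.
intros z Hz; assert (H : 0 < r - Rabs (z - x)) by lra.
exists (mkposreal _ H); intros z' Hz'; change (Rabs (z' - z) < r - Rabs (z - x)) in Hz'.
replace (z' - x) with ((z' - z) + (z - x)) by ring.
eapply Rle_lt_trans; [apply Rabs_triang | lra].
Qed.

Lemma open_box x y r : open (box x y r).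
Proof.
apply open_and.
- apply (open_strip (fun z => Rabs (z - x) < r)), open_interval.
- apply (open_comp (fun p : R * R => snd p) (fun z => Rabs (z - y) < r)), open_interval.
  intros [a b] _; apply (continuous_snd a b).
Qed.

Lemma box_center x y (r : posreal) : box x y r (x, y).
Proof.
split; simpl; rewrite Rminus_diag, Rabs_R0; apply cond_pos.
Qed.

Lemma open_preimage (D G : R * R -> Prop) f g :
  open D -> open G -> smooth2 D f -> smooth2 D g ->
  open (fun p => D p /\ G (f (fst p) (snd p), g (fst p) (snd p))).
Proof.
intros oD oG Hf Hg; apply open_2d; intros x y [Hp HG]; simpl in HG.
destruct (locally_2d_open _ _ _ oG HG) as [d Hd].
apply locally_2d_impl with (2 := locally_2d_open _ _ _ oD Hp).
apply locally_2d_impl with (2 := smooth2_cont _ _ _ _ Hf Hp d).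
apply locally_2d_impl with (2 := smooth2_cont _ _ _ _ Hg Hp d).
apply locally_2d_forall; intros u v H1 H2 H3; split; [exact H3 |].
now apply Hd.
Qed.

Lemma const_of_zero_derive (h : R -> R) c r :
  (forall z, Rabs (z - c) < r -> is_derive h z 0) ->
  forall z, Rabs (z - c) < r -> h z = h c.
Proof.
intros H z Hz.
destruct (Rtotal_order z c) as [L | [-> | L]]; [| reflexivity |].
- apply (eq_is_derive h z c); [| exact L]; intros t Ht; apply H.
  apply Rabs_lt_between in Hz; apply Rabs_lt_between; lra.
- symmetry; apply (eq_is_derive h c z); [| exact L]; intros t Ht; apply H.
  apply Rabs_lt_between in Hz; apply Rabs_lt_between; lra.
Qed.

(* [(t, x) |-> (t, f t x)] maps [N] bijectively onto the box of radius [r], with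
   inverse [(t, s) |-> (t, psi t s)]. *)
Definition straightens (D : R * R -> Prop) (f : R -> R -> R) (t0 x0 : R)
    (r : posreal) (N : R * R -> Prop) (psi : R -> R -> R) : Prop :=
  open N /\ N (t0, x0) /\ (forall p, N p -> D p) /\
  smooth2 (box t0 (f t0 x0) r) psi /\
  (forall t x, N (t, x) -> box t0 (f t0 x0) r (t, f t x) /\ psi t (f t x) = x) /\
  (forall t s, box t0 (f t0 x0) r (t, s) -> N (t, psi t s) /\ f t (psi t s) = s).

Section Implicit.

Variables (f : R -> R -> R) (t0 x0 : R) (d : posreal).
Hypothesis smf : smooth2 (box t0 x0 d) f.
Hypothesis pos : forall t x, box t0 x0 d (t, x) -> 0 < d2 f t x.

Lemma implicit_incr t x1 x2 : box t0 x0 d (t, x1) -> box t0 x0 d (t, x2) ->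
  x1 < x2 -> f t x1 < f t x2.
Proof.
intros [Ht H1] [_ H2] L; simpl in *.
apply Rabs_lt_between in H1; apply Rabs_lt_between in H2.
apply (incr_function (fun x => f t x) (x0 - d) (x0 + d) (fun x => d2 f t x));
  simpl; try lra; intros x G1 G2;
  (assert (B : box t0 x0 d (t, x)) by (split; [exact Ht | apply Rabs_lt_between; simpl; lra])).
- now apply (smooth2_is_derive (box t0 x0 d)).
- now apply pos.
Qed.

Lemma implicit_inj t x1 x2 : box t0 x0 d (t, x1) -> box t0 x0 d (t, x2) ->
  f t x1 = f t x2 -> x1 = x2.
Proof.
intros H1 H2 E; destruct (Rtotal_order x1 x2) as [L | [L | L]]; [| exact L |];
  apply implicit_incr with (t := t) in L; trivial; lra.
Qed.

Lemma implicit_ivt t s x1 x2 : box t0 x0 d (t, x1) -> box t0 x0 d (t, x2) ->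
  x1 < x2 -> f t x1 < s < f t x2 -> exists x, x1 < x < x2 /\ f t x = s.
Proof.
intros [Ht H1] [_ H2] L Hs; simpl in *.
apply Rabs_lt_between in H1; apply Rabs_lt_between in H2.
destruct (Ranalysis5.IVT_interv (fun x => f t x - s) x1 x2) as [x [Hx E]]; try lra.
- intros a Ha.
  assert (B : box t0 x0 d (t, a)) by (split; [exact Ht | apply Rabs_lt_between; simpl; lra]).
  apply continuity_pt_minus; [| apply continuity_pt_const; now intros ? ?].
  apply derivable_continuous_pt; exists (d2 f t a); apply is_derive_Reals.
  now apply (smooth2_is_derive (box t0 x0 d)).
- exists x; split; [| lra].
  destruct Hx as [[Hx | ->] [Hx' | Hx']]; try lra. subst x; lra.
Qed.

(** Monotonicity gives f t1 (x1 - e) < s1 < f t1 (x1 + e), and these strict inequalities survive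
    small changes of t and s. The intermediate value theorem then produces a root within e of x1,
    and injectivity identifies it with the value of [psi]. No regularity of [psi] is assumed. *)
Lemma implicit_cont psi (G : R * R -> Prop) : open G ->
  (forall t s, G (t, s) -> box t0 x0 d (t, psi t s) /\ f t (psi t s) = s) ->
  forall t s, G (t, s) -> continuity_2d_pt psi t s.
Proof.
intros oG HG t1 s1 H1 eps.
destruct (HG t1 s1 H1) as [Bx E]; set (x1 := psi t1 s1) in *.
assert (He : exists e, 0 < e /\ e <= eps /\ Rabs (x1 - x0) + e < d).
{ destruct Bx as [_ Bx]; simpl in Bx.
  exists (Rmin eps ((d - Rabs (x1 - x0)) / 2)).
  generalize (Rmin_l eps ((d - Rabs (x1 - x0)) / 2)) (Rmin_r eps ((d - Rabs (x1 - x0)) / 2)).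
  assert (0 < Rmin eps ((d - Rabs (x1 - x0)) / 2)); [| lra].
  apply Rmin_glb_lt; [apply cond_pos | lra]. }
destruct He as (e & He & He1 & He2).
assert (B : forall t x, Rabs (t - t0) < d -> Rabs (x - x1) <= e -> box t0 x0 d (t, x)).
{ intros t x Ht Hx; split; [exact Ht |]; simpl.
  replace (x - x0) with ((x - x1) + (x1 - x0)) by ring.
  eapply Rle_lt_trans; [apply Rabs_triang | lra]. }
assert (Ea : Rabs (x1 - e - x1) <= e).
{ replace (x1 - e - x1) with (- e) by ring; rewrite Rabs_Ropp, Rabs_pos_eq; lra. }
assert (Eb : Rabs (x1 + e - x1) <= e).
{ replace (x1 + e - x1) with e by ring; rewrite Rabs_pos_eq; lra. }
pose proof (proj1 Bx) as Bt; simpl in Bt.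
assert (La : f t1 (x1 - e) < s1).
{ rewrite <- E; apply implicit_incr; [now apply B | exact Bx | lra]. }
assert (Lb : s1 < f t1 (x1 + e)).
{ rewrite <- E; apply implicit_incr; [exact Bx | now apply B | lra]. }
assert (Ha : 0 < (s1 - f t1 (x1 - e)) / 2) by lra.
assert (Hb : 0 < (f t1 (x1 + e) - s1) / 2) by lra.
assert (Ca := locally_2d_1d_const_y _ _ _
  (smooth2_cont _ _ _ _ smf (B _ _ Bt Ea) (mkposreal _ Ha))).
assert (Cb := locally_2d_1d_const_y _ _ _
  (smooth2_cont _ _ _ _ smf (B _ _ Bt Eb) (mkposreal _ Hb))).
destruct Ca as [ra Ca]; destruct Cb as [rb Cb].
destruct (locally_2d_open _ _ _ oG H1) as [rg Cg].
assert (Hr : 0 < Rmin (Rmin ra rb) (Rmin rg (Rmin ((s1 - f t1 (x1 - e)) / 2) ((f t1 (x1 + e) - s1) / 2)))).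
{ repeat apply Rmin_glb_lt; trivial; apply cond_pos. }
exists (mkposreal _ Hr); simpl; intros t s Ht Hs.
assert (Mt : Rabs (t - t1) < ra /\ Rabs (t - t1) < rb /\ Rabs (t - t1) < rg).
{ repeat split; (eapply Rlt_le_trans; [exact Ht |]);
  [ eapply Rle_trans; [apply Rmin_l | apply Rmin_l]
  | eapply Rle_trans; [apply Rmin_l | apply Rmin_r]
  | eapply Rle_trans; [apply Rmin_r | apply Rmin_l]]. }
assert (Ms : Rabs (s - s1) < rg /\ Rabs (s - s1) < (s1 - f t1 (x1 - e)) / 2
  /\ Rabs (s - s1) < (f t1 (x1 + e) - s1) / 2).
{ repeat split; (eapply Rlt_le_trans; [exact Hs |]; eapply Rle_trans; [apply Rmin_r |]);
  [ apply Rmin_l | eapply Rle_trans; [apply Rmin_r | apply Rmin_l]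
  | eapply Rle_trans; [apply Rmin_r | apply Rmin_r]]. }
destruct Mt as (Mta & Mtb & Mtg); destruct Ms as (Msg & Msa & Msb).
specialize (Ca t Mta); specialize (Cb t Mtb); simpl in Ca, Cb.
destruct (HG t s (Cg t s Mtg Msg)) as [Bx' E'].
pose proof (proj1 Bx') as Bt'; simpl in Bt'.
apply Rabs_lt_between in Ca; apply Rabs_lt_between in Cb.
apply Rabs_lt_between in Msa; apply Rabs_lt_between in Msb.
destruct (implicit_ivt t s (x1 - e) (x1 + e)) as (x & Hx & Ex); try lra; try now apply B.
replace (psi t s) with x.
- apply Rabs_lt_between; lra.
- apply implicit_inj with t; [| exact Bx' | congruence].
  apply B; [exact Bt' |]; apply Rabs_le_between; lra.
Qed.

(** The linearization of [f] at (t1, x1) is solved for x - x1. Its remainder is small relative to |t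
    - t1| + |x - x1|, so a Lipschitz bound |x - x1| <= K A, with A = max(|t - t1|, |s - s1|), is
    needed first. *)
Lemma implicit_DL psi (G : R * R -> Prop) : open G ->
  (forall t s, G (t, s) -> box t0 x0 d (t, psi t s) /\ f t (psi t s) = s) ->
  forall t s, G (t, s) ->
  DL psi t s (- (d1 f t (psi t s) * / d2 f t (psi t s))) (/ d2 f t (psi t s)).
Proof.
intros oG HG t1 s1 H1 eps.
assert (C := implicit_cont psi G oG HG t1 s1 H1).
destruct (HG t1 s1 H1) as [Bx E]; set (x1 := psi t1 s1) in *.
assert (F := smooth2_DL _ _ _ _ (open_box t0 x0 d) smf Bx).
assert (Hm := pos _ _ Bx).
set (m := d2 f t1 x1) in *; set (p := d1 f t1 x1) in *.
(* With remainder at most (m / 2) (A + |x - x1|), the linearization gives m |x - x1| <= A + |p| A +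
   (m / 2) (A + |x - x1|); absorbing the last term on the left yields this constant. *)
set (K := 2 / m * (1 + Rabs p + m / 2)).
assert (HK : 1 <= K).
{ unfold K; replace (2 / m * (1 + Rabs p + m / 2)) with (1 + 2 * (1 + Rabs p) / m) by (field; lra).
  assert (0 <= 2 * (1 + Rabs p) / m); [| lra].
  apply Rdiv_le_0_compat; [| exact Hm]; generalize (Rabs_pos p); lra. }
assert (He : 0 < Rmin (m / 2) (eps * m / K)).
{ apply Rmin_glb_lt; [lra |]; apply Rdiv_lt_0_compat; [| lra].
  apply Rmult_lt_0_compat; [apply cond_pos | exact Hm]. }
(* The bound m / 2 serves the absorption that yields [K]; the bound eps * m / K makes the final
   error, divided by m, at most eps * A. *)
set (e := Rmin (m / 2) (eps * m / K)) in *.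
assert (He1 : e <= m / 2) by apply Rmin_l.
assert (He2 : e * K <= eps * m).
{ apply Rmult_le_reg_r with (/ K); [apply Rinv_0_lt_compat; lra |].
  replace (e * K * / K) with e by (field; lra); apply Rmin_r. }
destruct (F (mkposreal _ He)) as [rf Hf]; simpl in Hf.
destruct (C rf) as [rc Hc].
destruct (locally_2d_open _ _ _ oG H1) as [rg Cg].
assert (Hr : 0 < Rmin rf (Rmin rc rg)).
{ repeat apply Rmin_glb_lt; apply cond_pos. }
exists (mkposreal _ Hr); simpl; intros t s Ht Hs.
assert (M : forall z, z < Rmin rf (Rmin rc rg) -> z < rf /\ z < rc /\ z < rg).
{ intros z Hz; generalize (Rmin_l rf (Rmin rc rg)) (Rmin_r rf (Rmin rc rg))
   (Rmin_l rc rg) (Rmin_r rc rg); lra. }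
apply M in Ht; apply M in Hs.
specialize (Hc t s (proj1 (proj2 Ht)) (proj1 (proj2 Hs))).
destruct (HG t s (Cg t s (proj2 (proj2 Ht)) (proj2 (proj2 Hs)))) as [_ E'].
specialize (Hf t (psi t s) (proj1 Ht) Hc).
rewrite E', E in Hf; fold x1 in Hf |- *.
set (x := psi t s) in *.
set (A := Rmax (Rabs (t - t1)) (Rabs (s - s1))).
assert (At : Rabs (t - t1) <= A) by apply Rmax_l.
assert (As : Rabs (s - s1) <= A) by apply Rmax_r.
assert (Mx : Rmax (Rabs (t - t1)) (Rabs (x - x1)) <= Rabs (t - t1) + Rabs (x - x1)).
{ generalize (Rabs_pos (t - t1)) (Rabs_pos (x - x1)); intros; apply Rmax_lub; lra. }
assert (Hx : Rabs (x - x1) <= K * A).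
{ assert (T : m * Rabs (x - x1) <= Rabs (s - s1) + Rabs p * Rabs (t - t1) +
     Rabs (s - s1 - (p * (t - t1) + m * (x - x1)))).
  { rewrite <- (Rabs_pos_eq m) at 1 by lra; rewrite <- !Rabs_mult.
    replace (m * (x - x1)) with (((s - s1) + - (p * (t - t1))) +
      - (s - s1 - (p * (t - t1) + m * (x - x1)))) at 1 by ring.
    eapply Rle_trans; [apply Rabs_triang |]; rewrite Rabs_Ropp.
    apply Rplus_le_compat_r; eapply Rle_trans; [apply Rabs_triang |]; rewrite Rabs_Ropp.
    apply Rle_refl. }
  assert (T2 : e * Rmax (Rabs (t - t1)) (Rabs (x - x1)) <= m / 2 * (Rabs (t - t1) + Rabs (x - x1))).
  { apply Rmult_le_compat; trivial; [lra |].
    eapply Rle_trans; [apply Rabs_pos | apply Rmax_l]. }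
  assert (T3 : Rabs p * Rabs (t - t1) <= Rabs p * A).
  { apply Rmult_le_compat_l; [apply Rabs_pos | exact At]. }
  assert (T4 : m / 2 * Rabs (t - t1) <= m / 2 * A).
  { apply Rmult_le_compat_l; [lra | exact At]. }
  apply Rmult_le_reg_l with (m / 2); [lra |].
  replace (m / 2 * (K * A)) with ((1 + Rabs p + m / 2) * A) by (unfold K; field; lra).
  lra. }
assert (Hmax : Rmax (Rabs (t - t1)) (Rabs (x - x1)) <= K * A).
{ apply Rmax_lub; [| exact Hx]. apply Rle_trans with A; [exact At |].
  assert (0 <= A) by (apply Rle_trans with (2 := At), Rabs_pos).
  rewrite <- (Rmult_1_l A) at 1; now apply Rmult_le_compat_r. }
replace (x - x1 - (- (p * / m) * (t - t1) + / m * (s - s1)))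
  with (- / m * (s - s1 - (p * (t - t1) + m * (x - x1)))) by (field; lra).
rewrite Rabs_mult, Rabs_Ropp, (Rabs_pos_eq (/ m))
  by (left; now apply Rinv_0_lt_compat).
apply Rmult_le_reg_l with m; [exact Hm |].
rewrite <- Rmult_assoc, Rinv_r, Rmult_1_l by lra.
apply Rle_trans with (1 := Hf).
apply Rle_trans with (e * (K * A)); [apply Rmult_le_compat_l; lra |].
assert (0 <= A) by (apply Rle_trans with (2 := At), Rabs_pos).
apply Rle_trans with ((e * K) * A); [lra |].
apply Rle_trans with ((eps * m) * A); [now apply Rmult_le_compat_r | lra].
Qed.

(** The functions h(t, psi t s) with h smooth on the box are stable under differentiation, because
    the derivatives of [psi] are themselves smooth functions of (t, psi t s). *)
Lemma implicit_smooth psi (G : R * R -> Prop) : open G ->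
  (forall t s, G (t, s) -> box t0 x0 d (t, psi t s) /\ f t (psi t s) = s) ->
  smooth2 G psi.
Proof.
intros oG HG.
pose proof (open_box t0 x0 d) as oB.
assert (Si : smooth2 (box t0 x0 d) (fun t x => / d2 f t x)).
{ apply smooth2_inv; [assumption | now apply smooth2_d2 |].
  intros x y Hp; generalize (pos x y Hp); lra. }
apply (smooth2_coind G (fun g => exists h, smooth2 (box t0 x0 d) h /\
   g = fun t s => h t (psi t s))).
- assumption.
- intros g (h & Hh & ->).
  exists (fun t s => d1 h t (psi t s) + d2 h t (psi t s) * - (d1 f t (psi t s) * / d2 f t (psi t s))),
    (fun t s => d2 h t (psi t s) * / d2 f t (psi t s)).
  repeat split.
  + exists (fun t x => d1 h t x + d2 h t x * - (d1 f t x * / d2 f t x)); split; [| reflexivity].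
    apply smooth2_plus; [assumption | now apply smooth2_d1 |].
    apply smooth2_mult; [assumption | now apply smooth2_d2 |].
    apply smooth2_opp; [assumption |].
    apply smooth2_mult; [assumption | now apply smooth2_d1 | assumption].
  + exists (fun t x => d2 h t x * / d2 f t x); split; [| reflexivity].
    apply smooth2_mult; [assumption | now apply smooth2_d2 | assumption].
  + intros t s Hp; destruct (HG t s Hp) as [Bx _].
    eapply DL_eq; [eapply (differentiable_pt_lim_comp h (fun t _ => t) psi);
      [now apply (smooth2_DL (box t0 x0 d)) | apply DL_fst
      | now apply (implicit_DL psi G)] | ring | ring].
- exists (fun _ x => x); split; [now apply smooth2_snd | reflexivity].
Qed.

End Implicit.

Lemma implicit_function_pos D f t0 x0 :
  open D -> smooth2 D f -> D (t0, x0) -> 0 < d2 f t0 x0 ->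
  exists r N psi, straightens D f t0 x0 r N psi.
Proof.
intros oD Hf Hp Hd.
assert (Hd2 : 0 < d2 f t0 x0 / 2) by lra.
assert (L : locally_2d (fun t x => D (t, x) /\ 0 < d2 f t x) t0 x0).
{ apply locally_2d_impl with (2 := locally_2d_open _ _ _ oD Hp).
  apply locally_2d_impl with (2 := smooth2_cont _ _ _ _ (smooth2_d2 _ _ Hf) Hp (mkposreal _ Hd2)).
  apply locally_2d_forall; simpl; intros t x H1 H2; split; [exact H2 |].
  apply Rabs_lt_between in H1; lra. }
destruct L as [d Hbox].
assert (smf : smooth2 (box t0 x0 d) f).
{ apply smooth2_sub with D; [| exact Hf]. intros [t x] [H1 H2]; now apply Hbox. }
assert (pos : forall t x, box t0 x0 d (t, x) -> 0 < d2 f t x).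
{ intros t x [H1 H2]; now apply Hbox. }
assert (Hd0 := cond_pos d).
(* Half of [d] keeps the endpoints x0 - e and x0 + e, where [f] is evaluated, inside the box. *)
set (e := d / 2) in *.
assert (He : 0 < e < d) by (unfold e; lra).
assert (B : forall t x, Rabs (t - t0) < d -> Rabs (x - x0) <= e -> box t0 x0 d (t, x)).
{ intros t x Ht Hx; split; [exact Ht | simpl; lra]. }
assert (Bt : Rabs (t0 - t0) < d) by (rewrite Rminus_diag, Rabs_R0; lra).
assert (Bx : Rabs (x0 - x0) <= e) by (rewrite Rminus_diag, Rabs_R0; lra).
assert (Ea : Rabs (x0 - e - x0) <= e).
{ replace (x0 - e - x0) with (- e) by ring; rewrite Rabs_Ropp, Rabs_pos_eq; lra. }
assert (Eb : Rabs (x0 + e - x0) <= e).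
{ replace (x0 + e - x0) with e by ring; rewrite Rabs_pos_eq; lra. }
set (s0 := f t0 x0).
assert (La : f t0 (x0 - e) < s0) by (apply (implicit_incr f t0 x0 d); auto; lra).
assert (Lb : s0 < f t0 (x0 + e)) by (apply (implicit_incr f t0 x0 d); auto; lra).
assert (Ha : 0 < (s0 - f t0 (x0 - e)) / 2) by lra.
assert (Hb : 0 < (f t0 (x0 + e) - s0) / 2) by lra.
destruct (locally_2d_1d_const_y _ _ _
  (smooth2_cont _ _ _ _ smf (B _ _ Bt Ea) (mkposreal _ Ha))) as [ra Ca].
destruct (locally_2d_1d_const_y _ _ _
  (smooth2_cont _ _ _ _ smf (B _ _ Bt Eb) (mkposreal _ Hb))) as [rb Cb].
assert (Hr : exists r : posreal, r <= d /\ r <= ra /\ r <= rb /\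
   r <= (s0 - f t0 (x0 - e)) / 2 /\ r <= (f t0 (x0 + e) - s0) / 2).
{ assert (P : 0 < Rmin d (Rmin (Rmin ra rb) (Rmin ((s0 - f t0 (x0 - e)) / 2) ((f t0 (x0 + e) - s0) / 2)))).
  { repeat apply Rmin_glb_lt; trivial; apply cond_pos. }
  exists (mkposreal _ P); simpl.
  set (z1 := (s0 - _) / 2); set (z2 := (_ - s0) / 2).
  generalize (Rmin_l d (Rmin (Rmin ra rb) (Rmin z1 z2)))
   (Rmin_r d (Rmin (Rmin ra rb) (Rmin z1 z2)))
   (Rmin_l (Rmin ra rb) (Rmin z1 z2)) (Rmin_r (Rmin ra rb) (Rmin z1 z2))
   (Rmin_l ra rb) (Rmin_r ra rb) (Rmin_l z1 z2) (Rmin_r z1 z2); lra. }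
destruct Hr as (r & Hrd & Hra & Hrb & Hr1 & Hr2).
assert (Ex : forall t s, box t0 s0 r (t, s) ->
   exists x, box t0 x0 d (t, x) /\ f t x = s).
{ intros t s [Ht Hs]; simpl in Ht, Hs.
  assert (Ht' : Rabs (t - t0) < d) by lra.
  assert (Ca' := Ca t (Rlt_le_trans _ _ _ Ht Hra)); simpl in Ca'.
  assert (Cb' := Cb t (Rlt_le_trans _ _ _ Ht Hrb)); simpl in Cb'.
  apply Rabs_lt_between in Ca'; apply Rabs_lt_between in Cb'; apply Rabs_lt_between in Hs.
  destruct (implicit_ivt f t0 x0 d smf t s (x0 - e) (x0 + e)) as (x & Hx & E);
    auto; try lra.
  exists x; split; [| exact E]. apply B; [exact Ht' |]; apply Rabs_le_between; lra. }
(* A solution is picked by choice; it is unique in the box by strict monotonicity, and outside the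
   target box the value of [psi] is irrelevant. *)
set (psi := fun t s => epsilon (inhabits 0) (fun x => box t0 x0 d (t, x) /\ f t x = s)).
assert (Hpsi : forall t s, box t0 s0 r (t, s) -> box t0 x0 d (t, psi t s) /\ f t (psi t s) = s).
{ intros t s H; apply (epsilon_spec (inhabits 0) (fun x => box t0 x0 d (t, x) /\ f t x = s)).
  now apply Ex. }
(* Taking the preimage of the target box as domain makes the map a bijection onto that box. *)
exists r, (fun p => box t0 x0 d p /\ box t0 s0 r (fst p, f (fst p) (snd p))), psi.
split; [| split; [| split; [| split; [| split]]]].
- apply (open_preimage (box t0 x0 d) (box t0 s0 r) (fun t _ => t) f);
    auto using open_box, smooth2_fst.
- split; [apply box_center |]; simpl; apply box_center.
- intros [t x] [[H1 H2] _]; now apply Hbox.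
- apply (implicit_smooth f t0 x0 d smf pos); [apply open_box | exact Hpsi].
- intros t x [H1 H2]; simpl in H2; split; [exact H2 |].
  destruct (Hpsi t (f t x) H2) as [H3 H4].
  now apply (implicit_inj f t0 x0 d smf pos) with t.
- intros t s H; destruct (Hpsi t s H) as [H1 H2]; repeat split; try apply H1; try exact H2.
  + apply H.
  + simpl; rewrite H2; apply H.
Qed.

Lemma implicit_function D f t0 x0 :
  open D -> smooth2 D f -> D (t0, x0) -> d2 f t0 x0 <> 0 ->
  exists r N psi, straightens D f t0 x0 r N psi.
Proof.
intros oD Hf Hp Hd.
destruct (Rtotal_order 0 (d2 f t0 x0)) as [H | [H | H]]; [| congruence |].
- now apply implicit_function_pos.
(* A negative derivative is handled through - f, with s replaced by - s in the inverse. *)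
- destruct (implicit_function_pos D (fun t x => - f t x) t0 x0) as
   (r & N & psi & oN & N0 & ND & Sp & H1 & H2); auto using smooth2_opp.
  { destruct (DL_d _ _ _ _ _ (DL_opp _ _ _ _ _ (smooth2_DL _ _ _ _ oD Hf Hp))) as [_ ->]; lra. }
  assert (B : forall t s, box t0 (f t0 x0) r (t, s) <-> box t0 (- f t0 x0) r (t, - s)).
  { intros t s; unfold box; simpl.
    replace (- s - - f t0 x0) with (- (s - f t0 x0)) by ring; rewrite Rabs_Ropp; tauto. }
  exists r, N, (fun t s => psi t (- s)).
  split; [exact oN | split; [exact N0 | split; [exact ND | split; [| split]]]].
  + apply (smooth2_comp _ (box t0 (- f t0 x0) r) psi (fun t _ => t) (fun _ s => - s));
      auto using open_box, smooth2_fst, smooth2_opp, smooth2_snd.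
    intros t s; apply B.
  + intros t x Hx; destruct (H1 t x Hx) as [G E]; split; [now apply B | exact E].
  + intros t s Hs; apply B in Hs; destruct (H2 _ _ Hs) as [G E]; split; [exact G | lra].
Qed.

(** * Functional dependence of functions with zero Jacobian *)

Lemma straightens_DL D f t0 x0 r N psi t s :
  open D -> smooth2 D f -> straightens D f t0 x0 r N psi ->
  box t0 (f t0 x0) r (t, s) ->
  d1 f t (psi t s) + d2 f t (psi t s) * d1 psi t s = 0 /\
  d2 f t (psi t s) * d2 psi t s = 1.
Proof.
intros oD Hf (oN & N0 & ND & Sp & H1 & H2) Hs.
assert (A : DL (fun t s => f t (psi t s)) t s
   (d1 f t (psi t s) * 1 + d2 f t (psi t s) * d1 psi t s)
   (d1 f t (psi t s) * 0 + d2 f t (psi t s) * d2 psi t s)).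
{ apply (differentiable_pt_lim_comp f (fun t _ => t) psi).
  - apply (smooth2_DL D); trivial. apply ND, H2, Hs.
  - apply DL_fst.
  - apply (smooth2_DL (box t0 (f t0 x0) r)); auto using open_box. }
assert (B : DL (fun t s => f t (psi t s)) t s 0 1).
{ apply (DL_ext_open (box t0 (f t0 x0) r) (fun _ s => s)); auto using open_box, DL_snd.
  intros u v Huv; symmetry; now apply H2. }
destruct (DL_unique _ _ _ _ _ _ _ A B); lra.
Qed.

(** For fixed s the curve x = psi t s is a level curve of [f], with slope - f_t / f_x; along it the
    derivative of [g] is - jac f g / f_x = 0. *)
Lemma straightens_dependent D f g t0 x0 r N psi t s :
  open D -> smooth2 D f -> smooth2 D g ->
  (forall t x, D (t, x) -> jac f g t x = 0) ->
  straightens D f t0 x0 r N psi -> box t0 (f t0 x0) r (t, s) ->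
  g t (psi t s) = g t0 (psi t0 s).
Proof.
intros oD Hf Hg J S [Ht Hs]; simpl in Ht, Hs.
apply (const_of_zero_derive (fun t => g t (psi t s)) t0 r); [| exact Ht].
intros z Hz; assert (B : box t0 (f t0 x0) r (z, s)) by (split; trivial).
destruct (straightens_DL _ _ _ _ _ _ _ _ _ oD Hf S B) as [E1 E2].
destruct S as (oN & N0 & ND & Sp & H1 & H2).
assert (HD : D (z, psi z s)) by (apply ND, H2, B).
assert (A : DL (fun t s => g t (psi t s)) z s
   (d1 g z (psi z s) * 1 + d2 g z (psi z s) * d1 psi z s)
   (d1 g z (psi z s) * 0 + d2 g z (psi z s) * d2 psi z s)).
{ apply (differentiable_pt_lim_comp g (fun t _ => t) psi).
  - now apply (smooth2_DL D).
  - apply DL_fst.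
  - apply (smooth2_DL (box t0 (f t0 x0) r)); auto using open_box. }
destruct (DL_is_derive _ _ _ _ _ A) as [A1 _].
replace 0 with (d1 g z (psi z s) * 1 + d2 g z (psi z s) * d1 psi z s); [exact A1 |].
specialize (J _ _ HD); unfold jac in J.
set (ft := d1 f z (psi z s)) in *; set (fx := d2 f z (psi z s)) in *.
set (gt := d1 g z (psi z s)) in *; set (gx := d2 g z (psi z s)) in *.
set (pt := d1 psi z s) in *; set (ps := d2 psi z s) in *.
(* Since fx * ps = 1, inserting this factor replaces a division by fx. *)
replace (gt * 1 + gx * pt) with ((fx * ps) * (gt * 1 + gx * pt)) by (rewrite E2; ring).
replace (fx * ps * (gt * 1 + gx * pt)) with (ps * (gx * (ft + fx * pt) - (ft * gx - fx * gt))) by ring.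
rewrite E1, J; ring.
Qed.

Lemma functional_dependence_x D f g t0 x0 :
  open D -> smooth2 D f -> smooth2 D g -> D (t0, x0) ->
  (forall t x, D (t, x) -> jac f g t x = 0) -> d2 f t0 x0 <> 0 ->
  exists N I W, open N /\ N (t0, x0) /\ (forall p, N p -> D p) /\
    open I /\ smooth1 I W /\
    forall t x, N (t, x) -> I (f t x) /\ g t x = W (f t x).
Proof.
intros oD Hf Hg Hp J Hd.
destruct (implicit_function D f t0 x0 oD Hf Hp Hd) as (r & N & psi & S).
assert (S' := S); destruct S' as (oN & N0 & ND & Sp & H1 & H2).
(* [W] is [g] read off on the line t = t0, with the value of [f] as coordinate. *)
exists N, (fun s => Rabs (s - f t0 x0) < r), (fun s => g t0 (psi t0 s)).
split; [exact oN | split; [exact N0 | split; [exact ND | split; [| split]]]].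
- apply open_interval.
- assert (Hb : forall s, Rabs (s - f t0 x0) < r -> box t0 (f t0 x0) r (t0, s)).
  { intros s Hs; split; [apply box_center with (y := 0) | exact Hs]. }
  apply (smooth2_slice2 (box t0 (f t0 x0) r) _ (fun t s => g t (psi t s)));
    auto using open_box, open_interval.
  apply (smooth2_comp _ D g (fun t _ => t) psi); auto using open_box, smooth2_fst.
  intros t s Hs; apply ND, H2, Hs.
- intros t x Hx; destruct (H1 t x Hx) as [B E]; split; [apply B |].
  rewrite <- (straightens_dependent D f g t0 x0 r N psi t (f t x)); trivial.
  now rewrite E.
Qed.

Lemma functional_dependence D f g t0 x0 :
  open D -> smooth2 D f -> smooth2 D g -> D (t0, x0) ->
  (forall t x, D (t, x) -> jac f g t x = 0) ->
  d1 f t0 x0 <> 0 \/ d2 f t0 x0 <> 0 ->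
  exists N I W, open N /\ N (t0, x0) /\ (forall p, N p -> D p) /\
    open I /\ smooth1 I W /\
    forall t x, N (t, x) -> I (f t x) /\ g t x = W (f t x).
Proof.
intros oD Hf Hg Hp J [Hd | Hd]; [| now apply functional_dependence_x].
destruct (functional_dependence_x (fun p => D (snd p, fst p)) (fun x t => f t x)
  (fun x t => g t x) x0 t0) as (N & I & W & oN & N0 & ND & oI & SW & H);
  auto using open_swap, smooth2_swap.
- intros x t Hxt; specialize (J t x Hxt); unfold jac in *; simpl in Hxt |- *.
  change (d2 f t x * d1 g t x - d1 f t x * d2 g t x = 0); lra.
- exists (fun p => N (snd p, fst p)), I, W.
  split; [now apply open_swap |].
  split; [exact N0 | split; [| split; [exact oI | split; [exact SW |]]]].
  + intros [t x] Hx; exact (ND _ Hx).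
  + intros t x Hx; exact (H x t Hx).
Qed.

(** * The inverse function theorem in the plane *)

Definition inverse_on_box (D : R * R -> Prop) (u v : R -> R -> R) (t0 x0 : R)
    (r : posreal) (N : R * R -> Prop) (p q : R -> R -> R) : Prop :=
  open N /\ N (t0, x0) /\ (forall z, N z -> D z) /\
  smooth2 (box (u t0 x0) (v t0 x0) r) p /\ smooth2 (box (u t0 x0) (v t0 x0) r) q /\
  (forall t x, N (t, x) -> box (u t0 x0) (v t0 x0) r (u t x, v t x) /\
     p (u t x) (v t x) = t /\ q (u t x) (v t x) = x) /\
  (forall a b, box (u t0 x0) (v t0 x0) r (a, b) ->
     N (p a b, q a b) /\ u (p a b) (q a b) = a /\ v (p a b) (q a b) = b).

(** Two scalar eliminations: u = a is solved for x at fixed t, giving x = psi t a; then v(t, psi t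
    a) = b is solved for t at fixed a. The second is possible because the t-derivative of its left
    side is v_t - v_x u_t / u_x = - jac u v / u_x. *)
Lemma inverse_function_x D u v t0 x0 :
  open D -> smooth2 D u -> smooth2 D v -> D (t0, x0) ->
  jac u v t0 x0 <> 0 -> d2 u t0 x0 <> 0 ->
  exists r N p q, inverse_on_box D u v t0 x0 r N p q.
Proof.
intros oD Hu Hv Hp J Hd.
destruct (implicit_function D u t0 x0 oD Hu Hp Hd) as (r1 & N1 & psi & S).
assert (B0 : box t0 (u t0 x0) r1 (t0, u t0 x0)) by apply box_center.
destruct (straightens_DL _ _ _ _ _ _ _ _ _ oD Hu S B0) as [E1 _].
destruct S as (oN1 & N10 & N1D & Sp & H1 & H2).
assert (P0 : psi t0 (u t0 x0) = x0) by now apply H1.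
rewrite P0 in E1.
set (G1 := box t0 (u t0 x0) r1) in *.
assert (oG1 : open G1) by apply open_box.
set (k := fun a t => v t (psi t a)).
assert (Sk0 : smooth2 G1 (fun t a => v t (psi t a))).
{ apply (smooth2_comp _ D v (fun t _ => t) psi); auto using smooth2_fst.
  intros t a Ha; apply N1D, H2, Ha. }
assert (Sk := smooth2_swap _ _ oG1 Sk0).
destruct (implicit_function (fun p => G1 (snd p, fst p)) k (u t0 x0) t0)
  as (r2 & N2 & chi & oN2 & N20 & N2D & Sc & K1 & K2); auto using open_swap.
{ assert (A : DL (fun t a => v t (psi t a)) t0 (u t0 x0)
   (d1 v t0 (psi t0 (u t0 x0)) * 1 + d2 v t0 (psi t0 (u t0 x0)) * d1 psi t0 (u t0 x0))
   (d1 v t0 (psi t0 (u t0 x0)) * 0 + d2 v t0 (psi t0 (u t0 x0)) * d2 psi t0 (u t0 x0))).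
  { apply (differentiable_pt_lim_comp v (fun t _ => t) psi).
    - rewrite P0; now apply (smooth2_DL D).
    - apply DL_fst.
    - now apply (smooth2_DL G1). }
  destruct (DL_d _ _ _ _ _ (DL_swap _ _ _ _ _ A)) as [_ Ek].
  unfold k; rewrite Ek, P0; intros Z; apply J; unfold jac.
  replace (d1 v t0 x0) with (- (d2 v t0 x0 * d1 psi t0 (u t0 x0))) by lra.
  transitivity (d2 v t0 x0 * (d1 u t0 x0 + d2 u t0 x0 * d1 psi t0 (u t0 x0))); [ring |].
  rewrite E1; ring. }
assert (K0 : k (u t0 x0) t0 = v t0 x0) by (unfold k; now rewrite P0).
rewrite K0 in Sc, K1, K2.
exists r2, (fun p => N1 p /\ N2 (u (fst p) (snd p), fst p)), chi, (fun a b => psi (chi a b) a).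
assert (kE : forall t x, N1 (t, x) -> k (u t x) t = v t x).
{ intros t x Hx; unfold k; now rewrite (proj2 (H1 t x Hx)). }
split; [| split; [| split; [| split; [| split; [| split]]]]].
- apply (open_preimage N1 N2 u (fun t _ => t)); auto using smooth2_fst.
  now apply smooth2_sub with D.
- now split.
- intros z [Hz _]; auto.
- exact Sc.
- apply (smooth2_comp _ G1 psi chi (fun a _ => a)); auto using open_box, smooth2_fst.
  intros a b Hab; apply (N2D (a, chi a b)), K2, Hab.
- intros t x [Hx Hx2]; simpl in Hx2.
  destruct (K1 _ _ Hx2) as [A1 A2]; rewrite (kE t x Hx) in A1, A2.
  split; [exact A1 | split; [exact A2 |]].
  rewrite A2; now apply H1.
- intros a b Hab; destruct (K2 a b Hab) as [A1 A2].
  destruct (H2 _ _ (N2D _ A1)) as [A3 A4]; simpl in A3, A4.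
  repeat split; trivial. simpl; now rewrite A4.
Qed.

Lemma inverse_function D u v t0 x0 :
  open D -> smooth2 D u -> smooth2 D v -> D (t0, x0) -> jac u v t0 x0 <> 0 ->
  exists r N p q, inverse_on_box D u v t0 x0 r N p q.
Proof.
intros oD Hu Hv Hp J.
destruct (Req_dec (d2 u t0 x0) 0) as [Hd | Hd]; [| now apply inverse_function_x].
destruct (inverse_function_x (fun p => D (snd p, fst p)) (fun x t => u t x)
  (fun x t => v t x) x0 t0) as (r & N & p & q & oN & N0 & ND & Spp & Sq & H1 & H2);
  auto using open_swap, smooth2_swap.
- intros Z; apply J; unfold jac in *.
  change (d2 u t0 x0 * d1 v t0 x0 - d1 u t0 x0 * d2 v t0 x0 = 0) in Z; lra.
(* A nonzero Jacobian excludes that both derivatives of [u] vanish, so the exchanged problem is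
   solvable. *)
- intros Z; apply J; unfold jac; change (d1 u t0 x0 = 0) in Z; rewrite Z, Hd; ring.
- exists r, (fun z => N (snd z, fst z)), q, p.
  split; [now apply open_swap |].
  split; [exact N0 | split; [| split; [exact Sq | split; [exact Spp | split]]]].
  + intros [t x] Hx; exact (ND _ Hx).
  + intros t x Hx; destruct (H1 x t Hx) as (A & B & C); auto.
  + exact H2.
Qed.

(** * Primitives, and potentials of closed forms on a box *)

Lemma between_center c b r s : Rabs (b - c) < r -> Rmin c b <= s <= Rmax c b -> Rabs (s - c) < r.
Proof.
intros Hb Hs; apply Rabs_lt_between in Hb; apply Rabs_lt_between.
destruct (Rle_dec c b).
- rewrite Rmin_left, Rmax_right in Hs; lra.
- rewrite Rmin_right, Rmax_left in Hs; lra.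
Qed.

Lemma smooth2_continuous_slices D f x y : smooth2 D f -> D (x, y) ->
  continuous (fun z => f z y) x /\ continuous (fun z => f x z) y.
Proof.
intros Hf Hp; destruct (smooth2_is_derive D f x y Hf Hp) as [H1 H2].
split; apply (ex_derive_continuous (V := R_NormedModule)); eexists; eassumption.
Qed.

Lemma primitive_on_interval (m : R -> R) c r :
  (forall s, Rabs (s - c) < r -> continuous m s) ->
  forall z, Rabs (z - c) < r -> ex_RInt m c z /\ is_derive (RInt m c) z (m z).
Proof.
intros Hm.
assert (E : forall z, Rabs (z - c) < r -> ex_RInt m c z).
{ intros z Hz; apply (ex_RInt_continuous (V := R_CompleteNormedModule)).
  intros s Hs; apply Hm; now apply between_center with z. }
intros z Hz; split; [now apply E |].
apply (is_derive_RInt m (RInt m c) c z); [| now apply Hm].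
generalize (open_interval c r z Hz); apply filter_imp; intros y Hy.
apply (RInt_correct (V := R_CompleteNormedModule)), E, Hy.
Qed.

(** The Poincaré lemma. The form M da + L db is integrated from (a0, b0) first in a along b = b0,
    then in b; both segments stay in the box. *)
Lemma potential_on_box a0 b0 (r : posreal) M L :
  smooth2 (box a0 b0 r) M -> smooth2 (box a0 b0 r) L ->
  (forall a b, box a0 b0 r (a, b) -> d2 M a b = d1 L a b) ->
  exists Psi, smooth2 (box a0 b0 r) Psi /\
    forall a b, box a0 b0 r (a, b) -> DL Psi a b (M a b) (L a b).
Proof.
intros SM SL HML.
set (Psi := fun a b => RInt (fun s => M s b0) a0 a + RInt (fun s => L a s) b0 b).
assert (H0 : Rabs (b0 - b0) < r) by (rewrite Rminus_diag, Rabs_R0; apply cond_pos).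
assert (PM : forall a, Rabs (a - a0) < r ->
   is_derive (RInt (fun s => M s b0) a0) a (M a b0)).
{ intros a Ha; apply (primitive_on_interval (fun s => M s b0) a0 r); [| exact Ha].
  intros s Hs; now apply (smooth2_continuous_slices (box a0 b0 r)). }
assert (PL : forall a, Rabs (a - a0) < r -> forall b, Rabs (b - b0) < r ->
   ex_RInt (L a) b0 b /\ is_derive (RInt (L a) b0) b (L a b)).
{ intros a Ha; apply (primitive_on_interval (L a) b0 r).
  intros s Hs; now apply (smooth2_continuous_slices (box a0 b0 r)). }
assert (DP : forall a b, box a0 b0 r (a, b) -> DL Psi a b (M a b) (L a b)).
{ intros a b Hab; apply (DL_of_C1 (box a0 b0 r)); trivial.
  - apply open_box.
  - clear a b Hab; intros a b [Ha Hb]; simpl in Ha, Hb.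
    replace (M a b) with (M a b0 + (M a b - M a b0)) by ring.
    apply (is_derive_plus (fun a => RInt (fun s => M s b0) a0 a)
             (fun a => RInt (fun s => L a s) b0 b)); [now apply PM |].
    (* Differentiation under the integral sign leaves the integral of L_a, which closedness turns
       into that of M_b; the boundary term M a b0 cancels against the first segment. *)
    assert (I : is_RInt (fun s => Derive (fun u => L u s) a) b0 b (M a b - M a b0)).
    { apply is_RInt_ext with (fun s => d2 M a s).
      - intros s Hs; apply HML; split; [exact Ha |].
        apply between_center with b; [exact Hb | split; apply Rlt_le, Hs].
      - apply (is_RInt_derive (fun s => M a s)).
        + intros s Hs; apply (smooth2_is_derive (box a0 b0 r)); [exact SM |].
          split; [exact Ha | now apply between_center with b].
        + intros s Hs; apply (smooth2_continuous_slices (box a0 b0 r));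
            [now apply smooth2_d2 |].
          split; [exact Ha | now apply between_center with b]. }
    rewrite <- (is_RInt_unique _ _ _ _ I).
    apply (is_derive_RInt_param L b0 b a).
    + generalize (open_interval a0 r a Ha); apply filter_imp; intros a' Ha' s Hs.
      exists (d1 L a' s); apply (smooth2_is_derive (box a0 b0 r)); [exact SL |].
      split; [exact Ha' | now apply between_center with b].
    + intros s Hs; apply (smooth2_cont (box a0 b0 r) (d1 L)); [now apply smooth2_d1 |].
      split; [exact Ha | now apply between_center with b].
    + generalize (open_interval a0 r a Ha); apply filter_imp; intros a' Ha'.
      now apply PL.
  - destruct Hab as [Ha Hb]; simpl in Ha, Hb.
    rewrite <- (Rplus_0_l (L a b)).
    apply (is_derive_plus (fun _ => RInt (fun s => M s b0) a0 a)
             (fun b => RInt (fun s => L a s) b0 b));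
      [apply (is_derive_const (V := R_NormedModule)) | now apply PL].
  - now apply (smooth2_cont (box a0 b0 r)). }
exists Psi; split; [| exact DP].
apply smooth2_of_DL with M L; auto using open_box.
Qed.

(** * The families consist of solutions in the respective regimes *)

(** Differentiating the two relations gives linear equations for the gradients of [u] and [v] with
    the symmetric matrix of rows (A, B) and (B, A), where A = Phi_uu and B = Phi_uv. The gradient of
    omega follows, and is used both here and for the converse construction of [W]. *)
Lemma regular_family_DL (N G : R * R -> Prop) (u v Phi : R -> R -> R) :
  open N -> smooth2 N u -> smooth2 N v -> open G -> smooth2 G Phi ->
  (forall a b, G (a, b) ->
     partial_derive 0 2 Phi a b + d2 Phi a b = partial_derive 2 0 Phi a b) ->
  (forall t x, N (t, x) -> G (u t x, v t x) /\
     t = d1 Phi (u t x) (v t x) /\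
     x = u t x * d1 Phi (u t x) (v t x) - d2 Phi (u t x) (v t x) - Phi (u t x) (v t x)) ->
  forall t x, N (t, x) ->
    d1 u t x + u t x * d2 u t x + d2 v t x = 0 /\
    d1 v t x + u t x * d2 v t x + d2 u t x = 0 /\
    jac u v t x <> 0 /\
    DL (fun t x => exp (v t x) * d2 Phi (u t x) (v t x)) t x
       (u t x * exp (v t x)) (- exp (v t x)).
Proof.
intros oN Su Sv oG SP Tel H t x Hp.
destruct (H t x Hp) as [HG [Et Ex]].
assert (Du := smooth2_DL N u t x oN Su Hp).
assert (Dv := smooth2_DL N v t x oN Sv Hp).
assert (Dc : forall F, smooth2 G F -> DL (fun t x => F (u t x) (v t x)) t x
   (d1 F (u t x) (v t x) * d1 u t x + d2 F (u t x) (v t x) * d1 v t x)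
   (d1 F (u t x) (v t x) * d2 u t x + d2 F (u t x) (v t x) * d2 v t x)).
{ intros F SF; apply differentiable_pt_lim_comp; trivial.
  now apply (smooth2_DL G). }
assert (D0 := Dc Phi SP).
assert (D1 := Dc _ (smooth2_d1 _ _ SP)).
assert (D2 := Dc _ (smooth2_d2 _ _ SP)).
rewrite (smooth2_Schwarz G Phi _ _ oG SP HG) in D1.
specialize (Tel _ _ HG).
change (d2 (d2 Phi) (u t x) (v t x) + d2 Phi (u t x) (v t x)
   = d1 (d1 Phi) (u t x) (v t x)) in Tel.
destruct (DL_unique _ _ _ _ _ _ _ D1
  (DL_ext_open N _ _ t x 1 0 oN Hp (fun t x Hp => proj1 (proj2 (H t x Hp))) (DL_fst t x)))
  as [A1 A2].
destruct (DL_unique _ _ _ _ _ _ _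
  (DL_minus _ _ _ _ _ _ _ _ (DL_minus _ _ _ _ _ _ _ _ (DL_mult _ _ _ _ _ _ _ _ Du D1) D2) D0)
  (DL_ext_open N _ _ t x 0 1 oN Hp (fun t x Hp => proj2 (proj2 (H t x Hp))) (DL_snd t x)))
  as [B1 B2].
assert (Do := DL_mult _ _ _ _ _ _ _ _ (DL_comp1 exp _ _ _ _ _ _ (is_derive_exp _) Dv) D2).
cbv beta in Do, B1, B2.
unfold jac.
set (U := u t x) in *; set (V := v t x) in *.
set (ut := d1 u t x) in *; set (ux := d2 u t x) in *.
set (vt := d1 v t x) in *; set (vx := d2 v t x) in *.
set (A := d1 (d1 Phi) U V) in *; set (B := d1 (d2 Phi) U V) in *.
set (C := d2 (d2 Phi) U V) in *.
set (P1 := d1 Phi U V) in *; set (P2 := d2 Phi U V) in *.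
(* The telegraph equation eliminates Phi_vv; this is what makes the matrix symmetric with equal
   diagonal entries. *)
replace C with (A - P2) in * by lra.
rewrite A1 in B1; rewrite A2 in B2.
assert (E1 : B * ut + A * vt = U) by lra.
assert (E2 : B * ux + A * vx = -1) by lra.
(* Multiplicativity of determinants: this one identity shows that the matrix is invertible and that
   the Jacobian does not vanish. *)
assert (J : (A * A - B * B) * (ut * vx - ux * vt) = -1).
{ transitivity ((A * ut + B * vt) * (B * ux + A * vx) - (A * ux + B * vx) * (B * ut + A * vt)); [ring |].
  rewrite A1, A2, E1, E2; ring. }
assert (K : A * A - B * B <> 0) by (intros Z; rewrite Z in J; lra).
repeat split.
- apply Rmult_eq_reg_l with (2 := K).
  transitivity (A * ((A * ut + B * vt) + U * (A * ux + B * vx)) - B * ((B * ut + A * vt) + U * (B * ux + A * vx))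
     + A * (B * ux + A * vx) - B * (A * ux + B * vx)); [ring |].
  rewrite A1, A2, E1, E2; ring.
- apply Rmult_eq_reg_l with (2 := K).
  transitivity (A * ((B * ut + A * vt) + U * (B * ux + A * vx)) - B * ((A * ut + B * vt) + U * (A * ux + B * vx))
     + A * (A * ux + B * vx) - B * (B * ux + A * vx)); [ring |].
  rewrite A1, A2, E1, E2; ring.
- intros Z; rewrite Z in J; lra.
- eapply DL_eq; [exact Do | |].
  + rewrite <- E1; ring.
  + transitivity (exp V * (B * ux + A * vx)); [ring | rewrite E2; ring].
Qed.

Lemma regular_family_solution (N : R * R -> Prop) u v w :
  open N -> smooth2 N u -> smooth2 N v -> smooth2 N w ->
  regular_family N u v w ->
  solution N u v w /\ forall t x, N (t, x) -> regular_at u v t x.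
Proof.
intros oN Su Sv Sw (G & Phi & I & W & oG & SP & oI & SW & Tel & H).
assert (K := regular_family_DL N G u v Phi oN Su Sv oG SP (fun a b Hab => proj1 (Tel a b Hab))).
assert (H' : forall t x, N (t, x) -> G (u t x, v t x) /\
     t = d1 Phi (u t x) (v t x) /\
     x = u t x * d1 Phi (u t x) (v t x) - d2 Phi (u t x) (v t x) - Phi (u t x) (v t x)).
{ intros t x Hp; destruct (H t x Hp) as (HG & E & _); split; [exact HG |].
  apply E; auto. }
specialize (K H'); split.
- split; [exact Su | split; [exact Sv | split; [exact Sw |]]].
  intros t x Hp; destruct (K t x Hp) as (E1 & E2 & _ & Dom).
  split; [exact E1 | split; [exact E2 |]].
  destruct (H t x Hp) as (_ & _ & Io & _).
  assert (DW : is_derive W (exp (v t x) * d2 Phi (u t x) (v t x))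
    (Derive W (exp (v t x) * d2 Phi (u t x) (v t x)))) by (apply Derive_correct, (SW 1%nat), Io).
  destruct (DL_d w t x _ _ (DL_ext_open N _ w t x _ _ oN Hp
    (fun t x Hp => eq_sym (proj2 (proj2 (proj2 (H t x Hp)))))
    (DL_comp1 W _ (fun t x => exp (v t x) * d2 Phi (u t x) (v t x)) _ _ _ _ DW Dom)))
    as [-> ->].
  ring.
- intros t x Hp; apply (K t x Hp).
Qed.

(** Implicit differentiation of the relation gives Z u_t = - (u + eps) and Z u_x = 1 for a single
    factor Z, which therefore cannot vanish. *)
Lemma singular_family_DL (N : R * R -> Prop) (J : R -> Prop) u eps Theta :
  open N -> smooth2 N u -> open J -> smooth1 J Theta -> eps * eps = 1 ->
  (forall t x, N (t, x) -> J (u t x) /\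
     x - (u t x + eps) * t = exp (- eps * u t x) * Derive Theta (u t x)) ->
  forall t x, N (t, x) ->
    d1 u t x + (u t x + eps) * d2 u t x = 0 /\ d2 u t x <> 0 /\
    DL (fun t x => exp (eps * u t x) * t + eps * Derive Theta (u t x) - Theta (u t x)) t x
      (- u t x * (eps * exp (eps * u t x))) (eps * exp (eps * u t x)).
Proof.
intros oN Su oJ ST He H t x Hp.
destruct (H t x Hp) as [HJ E].
assert (Du := smooth2_DL N u t x oN Su Hp).
assert (T1 : is_derive Theta (u t x) (Derive Theta (u t x)))
  by apply Derive_correct, (ST 1%nat _ HJ).
assert (T2 : is_derive (Derive Theta) (u t x) (Derive_n Theta 2 (u t x)))
  by apply Derive_correct, (ST 2%nat _ HJ).
assert (De : forall k, DL (fun t x => exp (k * u t x)) t x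
   (k * exp (k * u t x) * d1 u t x) (k * exp (k * u t x) * d2 u t x)).
{ intros k; apply (DL_comp1 (fun z => exp (k * z))); [| exact Du].
  auto_derive; [exact I | ring]. }
assert (D1 := DL_comp1 _ _ _ _ _ _ _ T1 Du).
assert (D2 := DL_comp1 _ _ _ _ _ _ _ T2 Du).
assert (Dl := DL_minus _ _ _ _ _ _ _ _ (DL_snd t x)
  (DL_mult _ _ _ _ _ _ _ _ (DL_plus _ _ _ _ _ _ _ _ Du (DL_const eps t x)) (DL_fst t x))).
assert (Dr := DL_mult _ _ _ _ _ _ _ _ (De (- eps)) D2).
destruct (DL_unique _ _ _ _ _ _ _ Dl
  (DL_ext_open N _ _ _ _ _ _ oN Hp (fun t x Hp => eq_sym (proj2 (H t x Hp))) Dr)) as [A1 A2].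
assert (Dom := DL_minus _ _ _ _ _ _ _ _ (DL_plus _ _ _ _ _ _ _ _
  (DL_mult _ _ _ _ _ _ _ _ (De eps) (DL_fst t x))
  (DL_mult _ _ _ _ _ _ _ _ (DL_const eps t x) D2)) D1).
cbv beta in A1, A2, Dom.
assert (Ex : exp (eps * u t x) * exp (- eps * u t x) = 1).
{ rewrite <- exp_plus; replace (eps * u t x + - eps * u t x) with 0 by ring; apply exp_0. }
set (U := u t x) in *; set (ut := d1 u t x) in *; set (ux := d2 u t x) in *.
set (T' := Derive Theta U) in *; set (T'' := Derive_n Theta 2 U) in *.
set (e1 := exp (eps * U)) in *; set (e2 := exp (- eps * U)) in *.
(* [Z] is the derivative of [e2 * T' + (a + eps) * t] in [a] at [a = U]. *)
set (Z := t + e2 * (T'' - eps * T')).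
assert (B1 : Z * ut = - (U + eps)) by (unfold Z; lra).
assert (B2 : Z * ux = 1) by (unfold Z; lra).
assert (Zn : Z <> 0) by (intros Z0; rewrite Z0 in B2; lra).
(* The left side is the derivative of omega in u at fixed t. Being a multiple of [Z], it turns the
   unknown gradient of [u] into known quantities. *)
assert (C : e1 * eps * t + eps * T'' - T' = eps * e1 * Z).
{ unfold Z; transitivity (e1 * eps * t + (e1 * e2) * (eps * T'' - (eps * eps) * T')).
  - rewrite Ex, He; ring.
  - ring. }
repeat split.
- apply Rmult_eq_reg_l with (2 := Zn).
  transitivity (Z * ut + (U + eps) * (Z * ux)); [ring |].
  rewrite B1, B2; ring.
- intros Q; rewrite Q in B2; lra.
- eapply DL_eq; [exact Dom | |].
  + transitivity ((e1 * eps * t + eps * T'' - T') * ut + e1); [ring |].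
    rewrite C; transitivity (eps * e1 * (Z * ut) + e1); [ring |].
    rewrite B1; transitivity (- U * (eps * e1) - (eps * eps) * e1 + e1); [ring |].
    rewrite He; ring.
  + transitivity ((e1 * eps * t + eps * T'' - T') * ux); [ring |].
    rewrite C; transitivity (eps * e1 * (Z * ux)); [ring |].
    rewrite B2; ring.
Qed.

Lemma singular_family_solution (N : R * R -> Prop) u v w :
  open N -> smooth2 N u -> smooth2 N v -> smooth2 N w ->
  singular_family N u v w ->
  solution N u v w /\ forall t x, N (t, x) -> singular_at u v t x.
Proof.
intros oN Su Sv Sw (eps & c & J & Theta & I & W & Heps & oJ & ST & oI & SW & H).
assert (He : eps * eps = 1) by (destruct Heps as [-> | ->]; ring).
assert (H' : forall t x, N (t, x) -> J (u t x) /\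
     x - (u t x + eps) * t = exp (- eps * u t x) * Derive Theta (u t x)).
{ intros t x Hp; destruct (H t x Hp) as (HJ & E & _); split; [exact HJ |].
  now apply E. }
assert (K := singular_family_DL N J u eps Theta oN Su oJ ST He H').
assert (Dv : forall t x, N (t, x) -> d1 v t x = eps * d1 u t x /\ d2 v t x = eps * d2 u t x).
{ intros t x Hp; apply DL_d.
  apply (DL_ext_open N (fun t x => eps * u t x + c)); trivial.
  - intros t' x' Hp'; symmetry; apply (H t' x' Hp').
  - eapply DL_eq; [apply DL_plus; [apply DL_mult; [apply DL_const | now apply (smooth2_DL N)] | apply DL_const] | |]; cbv beta; ring. }
split.
- split; [exact Su | split; [exact Sv | split; [exact Sw |]]].
  intros t x Hp; destruct (K t x Hp) as (E & _ & Dom).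
  destruct (Dv t x Hp) as [-> ->].
  split; [lra | split].
  (* For v = eps u + c the second equation is eps times the first, since eps^2 = 1. *)
  + transitivity (eps * (d1 u t x + (u t x + eps) * d2 u t x) + (1 - eps * eps) * d2 u t x); [ring |].
    rewrite E, He; ring.
  + destruct (H t x Hp) as (_ & _ & _ & Io & _).
    match type of Io with I ?om => 
      assert (DW : is_derive W om (Derive W om)) by (apply Derive_correct, (SW 1%nat), Io) end.
    destruct (DL_d w t x _ _ (DL_ext_open N _ w t x _ _ oN Hp
      (fun t x Hp => eq_sym (proj2 (proj2 (proj2 (proj2 (H t x Hp))))))
      (DL_comp1 W _ (fun t x => exp (eps * u t x) * t + eps * Derive Theta (u t x)
         - Theta (u t x)) _ _ _ _ DW Dom))) as [-> ->].
    ring.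
- intros t x Hp; split.
  + apply locally_2d_impl with (2 := locally_2d_open _ _ _ oN Hp), locally_2d_forall.
    intros t' x' Hp'; unfold jac; destruct (Dv t' x' Hp') as [-> ->]; ring.
  + intros (_ & Z & _); now apply (K t x Hp).
Qed.

Lemma ultra_singular_family_solution (N : R * R -> Prop) u v w :
  open N -> smooth2 N u -> smooth2 N v -> smooth2 N w ->
  ultra_singular_family N u v w ->
  solution N u v w /\ forall t x, N (t, x) -> ultra_singular_at u v t x.
Proof.
intros oN Su Sv Sw (a & b & I & W & oI & SW & H); split.
- split; [exact Su | split; [exact Sv | split; [exact Sw |]]].
  intros t x Hp.
  destruct (DL_d u t x _ _ (DL_ext_open N _ u t x _ _ oN Hp
    (fun t x Hp => eq_sym (proj1 (H t x Hp))) (DL_const a t x))) as [-> ->].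
  destruct (DL_d v t x _ _ (DL_ext_open N _ v t x _ _ oN Hp
    (fun t x Hp => eq_sym (proj1 (proj2 (H t x Hp)))) (DL_const b t x))) as [-> ->].
  destruct (H t x Hp) as (-> & _ & Io & _).
  assert (DW : is_derive W (x - a * t) (Derive W (x - a * t)))
    by (apply Derive_correct, (SW 1%nat), Io).
  destruct (DL_d w t x _ _ (DL_ext_open N _ w t x _ _ oN Hp
    (fun t x Hp => eq_sym (proj2 (proj2 (proj2 (H t x Hp)))))
    (DL_comp1 W _ (fun t x => x - a * t) _ _ _ _ DW
      (DL_minus _ _ _ _ _ _ _ _ (DL_snd t x)
        (DL_mult _ _ _ _ _ _ _ _ (DL_const a t x) (DL_fst t x)))))) as [-> ->].
  repeat split; ring.
- intros t x Hp.
  apply locally_2d_impl with (2 := locally_2d_open _ _ _ oN Hp), locally_2d_forall.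
  intros t' x' Hp'.
  now destruct (H t x Hp) as (-> & -> & _), (H t' x' Hp') as (-> & -> & _).
Qed.

(** * Solutions belong to the family of their regime *)

Lemma const_on_box f x y (r : posreal) :
  (forall a b, box x y r (a, b) -> DL f a b 0 0) ->
  forall a b, box x y r (a, b) -> f a b = f x y.
Proof.
intros H a b [Ha Hb]; simpl in Ha, Hb.
transitivity (f x b).
- apply (const_of_zero_derive (fun a => f a b) x r); [| exact Ha].
  intros z Hz; apply (DL_is_derive f z b 0 0); apply H; now split.
- apply (const_of_zero_derive (fun b => f x b) y r); [| exact Hb].
  intros z Hz; apply (DL_is_derive f x z 0 0); apply H; split; [| exact Hz].
  apply (proj1 (box_center x y r)).
Qed.

Lemma smooth1_primitive m c r : smooth1 (fun z => Rabs (z - c) < r) m ->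
  exists P, smooth1 (fun z => Rabs (z - c) < r) P /\
    forall z, Rabs (z - c) < r -> is_derive P z (m z).
Proof.
intros Sm.
assert (H : forall z, Rabs (z - c) < r -> is_derive (RInt m c) z (m z)).
{ apply primitive_on_interval; intros s Hs.
  apply (ex_derive_continuous (V := R_NormedModule)), (Sm 1%nat s Hs). }
exists (RInt m c); split; [| exact H].
assert (oI := open_interval c r).
(* The second variable is a dummy, and 0 an arbitrary value for it. *)
apply (smooth2_slice1 (fun p => Rabs (fst p - c) < r) _ (fun z _ => RInt m c z) 0);
  [exact oI | trivial |].
apply smooth2_of_DL with (fun z _ => m z) (fun _ _ => 0).
- now apply (open_strip (fun z => Rabs (z - c) < r)).
- now apply (smooth1_strip (fun z => Rabs (z - c) < r)).
- now apply smooth2_const, (open_strip (fun z => Rabs (z - c) < r)).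
- intros z y Hz; apply (differentiable_pt_lim_proj1_0 (RInt m c)), is_derive_Reals.
  now apply H.
Qed.

(** Both gradients are orthogonal to (1, u), hence parallel. Here [u] is a number, so the lemma also
    serves for the speed u + eps. *)
Lemma jac_invariants u f g t x :
  d1 f t x + u * d2 f t x = 0 -> d1 g t x + u * d2 g t x = 0 -> jac f g t x = 0.
Proof.
intros Hf Hg; unfold jac.
replace (d1 f t x) with (- (u * d2 f t x)) by lra.
replace (d1 g t x) with (- (u * d2 g t x)) by lra.
ring.
Qed.

(** The derivative matrix of (T, X) is inverse to that of (u, v), so up to the common factor d its
    entries are those of the latter rearranged; the quasilinear equations become linear because u is
    now the independent variable a. *)
Lemma hodograph D u v w t0 x0 r N T X :
  open D -> solution D u v w -> inverse_on_box D u v t0 x0 r N T X ->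
  forall a b, box (u t0 x0) (v t0 x0) r (a, b) ->
  d2 T a b = a * d1 T a b - d1 X a b /\
  d2 X a b = a * d2 T a b - d1 T a b /\
  d1 T a b <> d2 T a b.
Proof.
intros oD (Su & Sv & _ & Sol) (oN & N0 & ND & ST & SX & H1 & H2) a b Hab.
destruct (H2 a b Hab) as (Hp & Ea & Eb).
assert (C : forall F, smooth2 (box (u t0 x0) (v t0 x0) r) F ->
  DL (fun t x => F (u t x) (v t x)) (T a b) (X a b)
   (d1 F a b * d1 u (T a b) (X a b) + d2 F a b * d1 v (T a b) (X a b))
   (d1 F a b * d2 u (T a b) (X a b) + d2 F a b * d2 v (T a b) (X a b))).
{ intros F SF; apply differentiable_pt_lim_comp.
  - rewrite Ea, Eb; apply (smooth2_DL (box (u t0 x0) (v t0 x0) r)); auto using open_box.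
  - apply (smooth2_DL D); auto.
  - apply (smooth2_DL D); auto. }
destruct (DL_unique _ _ _ _ _ _ _ (C T ST)
  (DL_ext_open N _ _ _ _ 1 0 oN Hp (fun t x Hp => eq_sym (proj1 (proj2 (H1 t x Hp)))) (DL_fst _ _)))
  as [A1 A2].
destruct (DL_unique _ _ _ _ _ _ _ (C X SX)
  (DL_ext_open N _ _ _ _ 0 1 oN Hp (fun t x Hp => eq_sym (proj2 (proj2 (H1 t x Hp)))) (DL_snd _ _)))
  as [B1 B2].
destruct (Sol _ _ (ND _ Hp)) as (E1 & E2 & _); rewrite Ea in E1, E2.
set (ut := d1 u (T a b) (X a b)) in *; set (ux := d2 u (T a b) (X a b)) in *.
set (vt := d1 v (T a b) (X a b)) in *; set (vx := d2 v (T a b) (X a b)) in *.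
set (Ta := d1 T a b) in *; set (Tb := d2 T a b) in *.
set (Xa := d1 X a b) in *; set (Xb := d2 X a b) in *.
set (d := Ta * Xb - Tb * Xa).
assert (F1 : Ta = d * vx).
{ transitivity (Ta * (Xa * ux + Xb * vx) - Xa * (Ta * ux + Tb * vx)).
  - rewrite A2, B2; ring.
  - unfold d; ring. }
assert (F2 : Tb = - (d * ux)).
{ transitivity (Tb * (Xa * ux + Xb * vx) - Xb * (Ta * ux + Tb * vx)).
  - rewrite A2, B2; ring.
  - unfold d; ring. }
assert (F3 : Xa = - (d * vt)).
{ transitivity (Xa * (Ta * ut + Tb * vt) - Ta * (Xa * ut + Xb * vt)).
  - rewrite A1, B1; ring.
  - unfold d; ring. }
assert (F4 : Xb = d * ut).
{ transitivity (Xb * (Ta * ut + Tb * vt) - Tb * (Xa * ut + Xb * vt)).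
  - rewrite A1, B1; ring.
  - unfold d; ring. }
assert (G1 : Tb = a * Ta - Xa).
{ rewrite F1, F2, F3; replace vt with (- (a * vx + ux)) by lra; ring. }
assert (G2 : Xb = a * Tb - Ta).
{ rewrite F1, F2, F4; replace ut with (- (a * ux + vx)) by lra; ring. }
split; [exact G1 | split; [exact G2 |]].
intros Z.
assert (J : (Ta * Xb - Tb * Xa) * (ut * vx - ux * vt) = 1).
{ transitivity ((Ta * ut + Tb * vt) * (Xa * ux + Xb * vx)
    - (Ta * ux + Tb * vx) * (Xa * ut + Xb * vt)); [ring |].
  rewrite A1, A2, B1, B2; ring. }
(* After this substitution the determinant is Tb^2 - Ta^2; if Ta = Tb it vanishes, although its
   product with the Jacobian of (u, v) is 1. *)
replace Xa with (a * Ta - Tb) in J by lra; rewrite G2, Z in J.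
replace (_ * _) with 0 in J by ring; lra.
Qed.

Lemma regular_potential a0 b0 (r : posreal) T X :
  smooth2 (box a0 b0 r) T -> smooth2 (box a0 b0 r) X ->
  (forall a b, box a0 b0 r (a, b) -> d2 T a b = a * d1 T a b - d1 X a b) ->
  exists Phi, smooth2 (box a0 b0 r) Phi /\
    forall a b, box a0 b0 r (a, b) ->
      d1 Phi a b = T a b /\ d2 Phi a b = a * T a b - X a b - Phi a b.
Proof.
intros ST SX H.
assert (oB := open_box a0 b0 r).
assert (SE : smooth2 (box a0 b0 r) (fun _ b => exp b)) by auto using smooth2_exp, smooth2_snd.
destruct (potential_on_box a0 b0 r (fun a b => exp b * T a b)
   (fun a b => exp b * (a * T a b - X a b))) as (Psi & SPsi & DPsi).
- now apply smooth2_mult.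
- apply smooth2_mult; auto using smooth2_minus, smooth2_mult, smooth2_fst.
- intros a b Hab.
  assert (DT := smooth2_DL _ _ _ _ oB ST Hab).
  assert (DX := smooth2_DL _ _ _ _ oB SX Hab).
  assert (De : DL (fun _ b => exp b) a b 0 (exp b)).
  { eapply DL_eq; [apply (DL_comp1 exp), DL_snd; apply is_derive_exp | ring | ring]. }
  destruct (DL_d _ _ _ _ _ (DL_mult _ _ _ _ _ _ _ _ De DT)) as [_ ->].
  destruct (DL_d _ _ _ _ _ (DL_mult _ _ _ _ _ _ _ _ De
    (DL_minus _ _ _ _ _ _ _ _ (DL_mult _ _ _ _ _ _ _ _ (DL_fst a b) DT) DX))) as [-> _].
  cbv beta; rewrite (H a b Hab); ring.
- exists (fun a b => exp (- b) * Psi a b); split.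
  + apply smooth2_mult; auto using smooth2_exp, smooth2_opp, smooth2_snd.
  + intros a b Hab.
    assert (De : DL (fun _ b => exp (- b)) a b 0 (- exp (- b))).
    { eapply DL_eq; [apply (DL_comp1 exp), DL_opp, DL_snd; apply is_derive_exp | ring | ring]. }
    assert (Ex : exp (- b) * exp b = 1).
    { rewrite <- exp_plus; replace (- b + b) with 0 by ring; apply exp_0. }
    destruct (DL_d _ _ _ _ _ (DL_mult _ _ _ _ _ _ _ _ De (DPsi a b Hab))) as [-> ->].
    cbv beta; split.
    * transitivity ((exp (- b) * exp b) * T a b); [ring | rewrite Ex; ring].
    * transitivity ((exp (- b) * exp b) * (a * T a b - X a b) - exp (- b) * Psi a b);
        [ring | rewrite Ex; ring].
Qed.

Lemma solution_regular D u v w t0 x0 :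
  open D -> solution D u v w -> D (t0, x0) -> regular_at u v t0 x0 ->
  belongs_near (fun N => regular_family N u v w) D t0 x0.
Proof.
intros oD HS Hp J.
assert (HS' := HS); destruct HS' as (Su & Sv & Sw & Sol).
destruct (inverse_function D u v t0 x0 oD Su Sv Hp J) as (r & N & T & X & Inv).
assert (Hod := hodograph D u v w t0 x0 r N T X oD HS Inv).
destruct Inv as (oN & N0 & ND & ST & SX & H1 & H2).
destruct (regular_potential _ _ r T X ST SX (fun a b Hab => proj1 (Hod a b Hab)))
  as (Phi & SPhi & HPhi).
set (G := box (u t0 x0) (v t0 x0) r) in *.
assert (oG : open G) by apply open_box.
assert (Tel : forall a b, G (a, b) ->
  partial_derive 0 2 Phi a b + d2 Phi a b = partial_derive 2 0 Phi a b /\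
  partial_derive 2 0 Phi a b <> partial_derive 1 1 Phi a b).
{ intros a b Hab.
  change (d2 (d2 Phi) a b + d2 Phi a b = d1 (d1 Phi) a b /\
    d1 (d1 Phi) a b <> d1 (d2 Phi) a b).
  destruct (Hod a b Hab) as (G1 & G2 & G3).
  assert (DT := smooth2_DL _ _ _ _ oG ST Hab).
  assert (DX := smooth2_DL _ _ _ _ oG SX Hab).
  assert (DPhi := smooth2_DL _ _ _ _ oG SPhi Hab).
  destruct (DL_d _ _ _ _ _ (DL_ext_open G T (d1 Phi) _ _ _ _ oG Hab
    (fun a b Hab => eq_sym (proj1 (HPhi a b Hab))) DT)) as [-> _].
  destruct (DL_d _ _ _ _ _ (DL_ext_open G _ (d2 Phi) _ _ _ _ oG Hab
    (fun a b Hab => eq_sym (proj2 (HPhi a b Hab)))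
    (DL_minus _ _ _ _ _ _ _ _ (DL_minus _ _ _ _ _ _ _ _
      (DL_mult _ _ _ _ _ _ _ _ (DL_fst a b) DT) DX) DPhi))) as [-> ->].
  rewrite (proj1 (HPhi a b Hab)).
  (* Here Phi_uu = T_a, Phi_uv = a T_a - X_a = T_b and Phi_vv + Phi_v = a T_b - X_b = T_a. *)
  split; [lra | intros Z; apply G3; lra]. }
assert (Su' := smooth2_sub _ _ _ ND Su).
assert (Sv' := smooth2_sub _ _ _ ND Sv).
assert (Sw' := smooth2_sub _ _ _ ND Sw).
assert (HG : forall t x, N (t, x) -> G (u t x, v t x) /\
     t = d1 Phi (u t x) (v t x) /\
     x = u t x * d1 Phi (u t x) (v t x) - d2 Phi (u t x) (v t x) - Phi (u t x) (v t x)).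
{ intros t x Htx; destruct (H1 t x Htx) as (A & B & C).
  destruct (HPhi _ _ A) as [-> ->]; rewrite B, C; split; [exact A | split; ring]. }
assert (K := regular_family_DL N G u v Phi oN Su' Sv' oG SPhi
  (fun a b Hab => proj1 (Tel a b Hab)) HG).
set (om := fun t x => exp (v t x) * d2 Phi (u t x) (v t x)) in *.
destruct (functional_dependence N om w t0 x0) as (N' & I & W & oN' & N0' & NN & oI & SW & HW);
  trivial.
- apply smooth2_mult; [exact oN | now apply smooth2_exp |].
  apply (smooth2_comp N G (d2 Phi) u v); trivial; [now apply smooth2_d2 |].
  intros t x Htx; apply HG, Htx.
- intros t x Htx; apply jac_invariants with (u t x).
  + destruct (DL_d _ _ _ _ _ (proj2 (proj2 (proj2 (K t x Htx))))) as [-> ->]; ring.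
  + apply (Sol t x (ND _ Htx)).
- right; destruct (DL_d _ _ _ _ _ (proj2 (proj2 (proj2 (K t0 x0 N0))))) as [_ ->].
  generalize (exp_pos (v t0 x0)); lra.
- exists N'; split; [exact oN' | split; [exact N0' | split; [auto |]]].
  (* Only the domain in (t, x) shrinks to [N']; uniqueness of (u, v) still holds among all points of
     the box [G]. *)
  exists G, Phi, I, W.
  do 4 (split; [assumption |]); split; [exact Tel |].
  intros t x Htx; assert (Hn := NN _ Htx).
  split; [apply HG, Hn | split; [| apply HW, Htx]].
  intros a b Hab; split.
  + intros [-> ->]; apply HG, Hn.
  + destruct (HPhi a b Hab) as [-> ->]; intros [Et Ex].
    assert (Ex' : x = X a b) by (rewrite Ex; ring).
    (* The relations say (t, x) = (T a b, X a b), and (u, v) inverts (T, X) on the whole box. *)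
    rewrite Et, Ex'; destruct (H2 a b Hab) as (_ & A & B); now split.
Qed.

(** The vanishing Jacobian factors as (u_x - v_x)(u_x + v_x) = 0, which fixes a sign at each point
    separately; the content is that the sign is locally constant. *)
Lemma singular_direction D u v w t0 x0 :
  open D -> solution D u v w -> D (t0, x0) -> singular_at u v t0 x0 ->
  exists eps (d : posreal), (eps = 1 \/ eps = -1) /\
    forall t x, box t0 x0 d (t, x) -> D (t, x) /\ d2 u t x <> 0 /\
      d1 u t x = - (u t x + eps) * d2 u t x /\
      d1 v t x = eps * d1 u t x /\ d2 v t x = eps * d2 u t x.
Proof.
intros oD (Su & Sv & _ & Sol) Hp [J Hn].
assert (Q : forall t x, D (t, x) -> jac u v t x = 0 ->
   (d2 v t x - d2 u t x) * (d2 v t x + d2 u t x) = 0).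
{ intros t x Htx Jz; destruct (Sol t x Htx) as (E1 & E2 & _); unfold jac in Jz.
  replace (d1 u t x) with (- (u t x * d2 u t x + d2 v t x)) in Jz by lra.
  replace (d1 v t x) with (- (u t x * d2 v t x + d2 u t x)) in Jz by lra.
  lra. }
assert (J0 := locally_2d_singleton _ _ _ J).
assert (Heps : exists eps, (eps = 1 \/ eps = -1) /\ d2 v t0 x0 = eps * d2 u t0 x0).
{ destruct (Rmult_integral _ _ (Q _ _ Hp J0)).
  - exists 1; split; [now left | lra].
  - exists (-1); split; [now right | lra]. }
destruct Heps as (eps & Heps & E).
assert (He : eps * eps = 1) by (destruct Heps as [-> | ->]; ring).
(* If u_x = 0, then v_x = eps u_x = 0, and the system makes the t-derivatives vanish as well. *)
assert (U0 : d2 u t0 x0 <> 0).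
{ intros Z; apply Hn; destruct (Sol t0 x0 Hp) as (E1 & E2 & _).
  rewrite Z, E in *; repeat split; try lra. }
(* At the base point this complementary factor is 2 eps u_x, hence nonzero; by continuity it stays
   so nearby, and the other factor must vanish there. *)
assert (L : locally_2d (fun t x => d2 v t x + eps * d2 u t x <> 0) t0 x0).
{ apply continuity_2d_pt_neq_0.
  - apply (smooth2_cont D (fun t x => d2 v t x + eps * d2 u t x)); [| exact Hp].
    apply smooth2_plus; auto using smooth2_mult, smooth2_const, smooth2_d2.
  - rewrite E; intros Z; apply U0.
    destruct Heps as [-> | ->]; lra. }
destruct (locally_2d_and _ _ _ _ L (locally_2d_and _ _ _ _ J (locally_2d_open _ _ _ oD Hp)))
  as [d Hd].
exists eps, d; split; [exact Heps |].
intros t x [Ht Hx]; destruct (Hd t x Ht Hx) as (Ln & Jz & Htx).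
assert (Ev : d2 v t x = eps * d2 u t x).
{ assert (Z : (d2 v t x - eps * d2 u t x) * (d2 v t x + eps * d2 u t x) = 0).
  { transitivity ((d2 v t x - d2 u t x) * (d2 v t x + d2 u t x)
      + (1 - eps * eps) * (d2 u t x * d2 u t x)); [ring |].
    rewrite (Q t x Htx Jz), He; ring. }
  destruct (Rmult_integral _ _ Z); [lra | contradiction]. }
destruct (Sol t x Htx) as (E1 & E2 & _); rewrite Ev in E1, E2, Ln.
assert (Eu : d1 u t x = - (u t x + eps) * d2 u t x) by lra.
repeat split; trivial.
- intros Z; apply Ln; rewrite Z; ring.
- rewrite Eu; transitivity (- (u t x * eps) * d2 u t x - (eps * eps) * d2 u t x); [| ring].
  rewrite He; lra.
Qed.

Lemma solution_singular D u v w t0 x0 :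
  open D -> solution D u v w -> D (t0, x0) -> singular_at u v t0 x0 ->
  belongs_near (fun N => singular_family N u v w) D t0 x0.
Proof.
intros oD HS Hp Hsing.
destruct (singular_direction D u v w t0 x0 oD HS Hp Hsing) as (eps & d & Heps & Hd).
assert (He : eps * eps = 1) by (destruct Heps as [-> | ->]; ring).
destruct HS as (Su & Sv & Sw & Sol).
set (B := box t0 x0 d) in *.
assert (oB : open B) by apply open_box.
assert (B0 : B (t0, x0)) by apply box_center.
assert (BD : forall p, B p -> D p) by (intros [t x] Htx; now apply Hd).
assert (SuB := smooth2_sub _ _ _ BD Su).
assert (SvB := smooth2_sub _ _ _ BD Sv).
assert (Cv : forall t x, B (t, x) -> v t x = eps * u t x + (v t0 x0 - eps * u t0 x0)).
{ intros t x Htx.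
  assert (E := const_on_box (fun t x => v t x - eps * u t x) t0 x0 d).
  cut (v t x - eps * u t x = v t0 x0 - eps * u t0 x0); [lra |].
  apply E; [| exact Htx].
  clear t x Htx; intros t x Htx; destruct (Hd t x Htx) as (_ & _ & _ & Ev1 & Ev2).
  eapply DL_eq; [apply DL_minus; [| apply DL_mult; [apply DL_const |]];
    apply (smooth2_DL B); eassumption | |]; cbv beta; rewrite ?Ev1, ?Ev2; ring. }
(* [u] satisfies u_t + (u + eps) u_x = 0, and [h] is constant along the same straight
   characteristics, hence a function of [u]. *)
set (h := fun t x => x - (u t x + eps) * t).
assert (Sh : smooth2 B h).
{ apply smooth2_minus; [assumption | now apply smooth2_snd |].
  apply smooth2_mult; [assumption | | now apply smooth2_fst].
  apply smooth2_plus; auto using smooth2_const. }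
assert (Jh : forall t x, B (t, x) -> jac u h t x = 0).
{ intros t x Htx; apply jac_invariants with (u t x + eps);
    destruct (Hd t x Htx) as (_ & _ & Eu & _); [rewrite Eu; ring |].
  assert (Dh := DL_minus _ _ _ _ _ _ _ _ (DL_snd t x)
    (DL_mult _ _ _ _ _ _ _ _ (DL_plus _ _ _ _ _ _ _ _ (smooth2_DL B u t x oB SuB Htx)
      (DL_const eps t x)) (DL_fst t x))).
  destruct (DL_d h _ _ _ _ Dh) as [-> ->]; rewrite Eu; ring. }
destruct (implicit_function B u t0 x0 oB SuB B0 (proj1 (proj2 (Hd _ _ B0))))
  as (r & N & psi & S).
assert (Dep := fun t s => straightens_dependent B u h t0 x0 r N psi t s oB SuB Sh Jh S).
destruct S as (oN & N0 & NB & Sp & H1 & H2).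
set (J := fun s => Rabs (s - u t0 x0) < r).
assert (oJ : open J) by apply open_interval.
assert (HJ : forall t x, N (t, x) -> J (u t x)) by (intros t x Htx; apply (H1 t x Htx)).
assert (T0 : forall s, J s -> box t0 (u t0 x0) r (t0, s)).
{ intros s Hs; split; [apply (proj1 (box_center t0 0 r)) | exact Hs]. }
(* [h] as a function of the value s of [u] is read off at t = t0; the required relation h = exp (-
   eps s) Theta'(s) then prescribes the derivative of [Theta]. *)
destruct (smooth1_primitive (fun s => exp (eps * s) * h t0 (psi t0 s)) (u t0 x0) r)
  as (Theta & STh & DTh).
{ assert (oG := open_box t0 (u t0 x0) r).
  apply (smooth2_slice2 (box t0 (u t0 x0) r) J (fun t s => exp (eps * s) * h t (psi t s)));
    trivial.
  apply smooth2_mult; [exact oG | |].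
  - apply smooth2_exp; auto using smooth2_mult, smooth2_const, smooth2_snd.
  - apply (smooth2_comp _ B h (fun t _ => t) psi); auto using smooth2_fst.
    intros t s Hs; apply NB, H2, Hs. }
fold J in STh, DTh.
assert (Eq : forall t x, N (t, x) -> forall a, J a ->
  (a = u t x <-> x - (a + eps) * t = exp (- eps * a) * Derive Theta a)).
{ intros t x Htx a Ha.
  rewrite (is_derive_unique _ _ _ (DTh a Ha)).
  assert (Ex : exp (- eps * a) * (exp (eps * a) * h t0 (psi t0 a)) = h t0 (psi t0 a)).
  { rewrite <- Rmult_assoc, <- exp_plus.
    replace (- eps * a + eps * a) with 0 by ring; rewrite exp_0; ring. }
  rewrite Ex.
  destruct (H1 t x Htx) as [[Ht _] Ep].
  assert (Hb : box t0 (u t0 x0) r (t, a)) by (split; [exact Ht | exact Ha]).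
  (* The right side becomes [h] at (t, psi t a), the point at time t where u = a. Both sides then
     contain the same term (a + eps) t, and the relation reduces to x = psi t a. *)
  rewrite <- (Dep t a Hb).
  destruct (H2 t a Hb) as [_ Ea]; unfold h; rewrite Ea; split.
  - intros ->; now rewrite Ep.
  - intros E; assert (E' : psi t a = x) by lra; now rewrite <- E'. }
assert (NE : forall t x, N (t, x) -> J (u t x) /\
     x - (u t x + eps) * t = exp (- eps * u t x) * Derive Theta (u t x)).
{ intros t x Htx; split; [now apply HJ |]; apply (Eq t x Htx); auto. }
assert (SuN := smooth2_sub _ _ _ NB SuB).
assert (K := singular_family_DL N J u eps Theta oN SuN oJ STh He NE).
set (om := fun t x => exp (eps * u t x) * t + eps * Derive Theta (u t x) - Theta (u t x)) in *.
destruct (functional_dependence N om w t0 x0) as (N' & I & W & oN' & N0' & NN & oI & SW & HW);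
  trivial.
- apply smooth2_minus; [assumption | apply smooth2_plus; [assumption | |] |].
  + apply smooth2_mult; [assumption | | now apply smooth2_fst].
    apply smooth2_exp; auto using smooth2_mult, smooth2_const.
  + apply smooth2_mult; [assumption | now apply smooth2_const |].
    apply (smooth2_comp N (fun p => J (fst p)) (d1 (fun z _ => Theta z)) u u); trivial.
    * now apply open_strip.
    * now apply smooth2_d1, smooth1_strip.
  + now apply (smooth2_comp1 N J).
- apply smooth2_sub with D; auto.
- intros t x Htx; apply jac_invariants with (u t x).
  + destruct (DL_d _ _ _ _ _ (proj2 (proj2 (K t x Htx)))) as [-> ->]; ring.
  + apply (Sol t x (BD _ (NB _ Htx))).
- right; destruct (DL_d _ _ _ _ _ (proj2 (proj2 (K t0 x0 N0)))) as [_ ->].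
  generalize (exp_pos (eps * u t0 x0)); destruct Heps as [-> | ->]; lra.
- exists N'; split; [exact oN' | split; [exact N0' | split; [auto |]]].
  exists eps, (v t0 x0 - eps * u t0 x0), J, Theta, I, W.
  do 5 (split; [assumption |]).
  intros t x Htx; assert (Hn := NN _ Htx).
  split; [now apply HJ | split; [now apply Eq | split; [now apply Cv, NB |]]].
  exact (HW t x Htx).
Qed.

Lemma solution_ultra_singular D u v w t0 x0 :
  open D -> solution D u v w -> D (t0, x0) -> ultra_singular_at u v t0 x0 ->
  belongs_near (fun N => ultra_singular_family N u v w) D t0 x0.
Proof.
intros oD (_ & _ & Sw & Sol) Hp H.
destruct (locally_2d_and _ _ _ _ H (locally_2d_open _ _ _ oD Hp)) as [d Hd].
set (a := u t0 x0) in *.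
assert (oB := open_box t0 x0 d).
assert (Df : forall t x, d1 (fun t x => x - a * t) t x = - a /\ d2 (fun t x => x - a * t) t x = 1).
{ intros t x; apply DL_d; eapply DL_eq; [apply DL_minus; [apply DL_snd |
    apply DL_mult; [apply DL_const | apply DL_fst]] | |]; cbv beta; ring. }
destruct (functional_dependence (box t0 x0 d) (fun t x => x - a * t) w t0 x0)
  as (N & I & W & oN & N0 & NB & oI & SW & HW); trivial.
- apply smooth2_minus; auto using smooth2_mult, smooth2_const, smooth2_fst, smooth2_snd.
- apply smooth2_sub with D; [| exact Sw]. intros [t x] [Ht Hx]; now apply Hd.
- apply box_center.
- intros t x [Ht Hx]; destruct (Hd t x Ht Hx) as [[Eu _] HD].
  apply jac_invariants with a; [destruct (Df t x) as [-> ->]; ring |].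
  (* Near the point [u] equals [a], so the third equation is transport with constant speed. *)
  rewrite <- Eu; apply (Sol t x HD).
- right; rewrite (proj2 (Df t0 x0)); lra.
- exists N; split; [exact oN | split; [exact N0 | split]].
  + intros [t x] Htx; destruct (NB _ Htx) as [Ht Hx]; now apply Hd.
  + exists a, (v t0 x0), I, W; split; [exact oI | split; [exact SW |]].
    intros t x Htx; destruct (NB _ Htx) as [Ht Hx].
    destruct (Hd t x Ht Hx) as [[Eu Ev] _].
    split; [exact Eu | split; [exact Ev | exact (HW t x Htx)]].
Qed.

(** * Density of the three regimes, and the classification *)

(** If a neighbourhood contains no regular point, the Jacobian vanishes on it; if it contains no
    singular point either, all first derivatives of [u] and [v] vanish on it. Then both are constant
    near (t, x), which is itself ultra-singular. *)
Lemma regimes_dense D u v w t x (r : posreal) :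
  open D -> solution D u v w -> D (t, x) ->
  exists t' x', D (t', x') /\ ball (t, x) r (t', x') /\
    (regular_at u v t' x' \/ singular_at u v t' x' \/ ultra_singular_at u v t' x').
Proof.
intros oD (Su & Sv & _) Hp.
apply NNPP; intros Hno.
set (E := fun p => D p /\ box t x r p).
assert (oE : open E) by (apply open_and; [exact oD | apply open_box]).
assert (E0 : E (t, x)) by (split; [exact Hp | apply box_center]).
assert (Hno' : forall t' x', E (t', x') ->
  ~ (regular_at u v t' x' \/ singular_at u v t' x' \/ ultra_singular_at u v t' x')).
{ intros t' x' [HD [Ht Hx]] Hc; apply Hno; exists t', x'; split; [exact HD |].
  split; [split; [exact Ht | exact Hx] | exact Hc]. }
assert (Jz : forall t' x', E (t', x') -> jac u v t' x' = 0).
{ intros t' x' HE; apply NNPP; intros Hj; apply (Hno' t' x' HE); now left. }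
assert (Gz : forall t' x', E (t', x') ->
  d1 u t' x' = 0 /\ d2 u t' x' = 0 /\ d1 v t' x' = 0 /\ d2 v t' x' = 0).
{ intros t' x' HE; apply NNPP; intros Hg; apply (Hno' t' x' HE); right; left; split; [| exact Hg].
  apply locally_2d_impl with (2 := locally_2d_open _ _ _ oE HE), locally_2d_forall; auto. }
apply (Hno' t x E0); right; right.
destruct (locally_2d_open _ _ _ oE E0) as [d Hd].
exists d; intros t' x' Ht Hx.
assert (HB : forall a b, box t x d (a, b) -> E (a, b)) by (intros a b [Ha Hb]; now apply Hd).
split; (apply const_on_box with d; [| now split]); intros a b Hab; apply HB in Hab;
  destruct (Gz a b Hab) as (Z1 & Z2 & Z3 & Z4).
- rewrite <- Z1 at 1; rewrite <- Z2; apply (smooth2_DL D); trivial; apply Hab.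
- rewrite <- Z3 at 1; rewrite <- Z4; apply (smooth2_DL D); trivial; apply Hab.
Qed.

Theorem theorem17 :
  (* every solution locally belongs to one of the families, according to the
     regime, and the points covered by the three regimes are dense *)
  (forall (D : R * R -> Prop) (u v w : R -> R -> R),
     open D -> solution D u v w ->
     (forall t x : R, D (t, x) -> forall r : posreal,
        exists t' x' : R, D (t', x') /\ ball (t, x) r (t', x') /\
          (regular_at u v t' x' \/ singular_at u v t' x' \/
           ultra_singular_at u v t' x')) /\
     (forall t x : R, D (t, x) -> regular_at u v t x ->
        belongs_near (fun N => regular_family N u v w) D t x) /\
     (forall t x : R, D (t, x) -> singular_at u v t x ->
        belongs_near (fun N => singular_family N u v w) D t x) /\
     (forall t x : R, D (t, x) -> ultra_singular_at u v t x ->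
        belongs_near (fun N => ultra_singular_family N u v w) D t x)) /\
  (* conversely, the families consist of solutions in the respective regimes *)
  (forall (N : R * R -> Prop) (u v w : R -> R -> R),
     open N -> smooth2 N u -> smooth2 N v -> smooth2 N w ->
     (regular_family N u v w ->
        solution N u v w /\
        forall t x : R, N (t, x) -> regular_at u v t x) /\
     (singular_family N u v w ->
        solution N u v w /\
        forall t x : R, N (t, x) -> singular_at u v t x) /\
     (ultra_singular_family N u v w ->
        solution N u v w /\
        forall t x : R, N (t, x) -> ultra_singular_at u v t x)).
Proof.
split.
- intros D u v w oD HS; split; [| split; [| split]]; intros t x Hp.
  + intros r; now apply (regimes_dense D u v w t x r).
  + now apply solution_regular.
  + now apply solution_singular.
  + now apply solution_ultra_singular.
- intros N u v w oN Su Sv Sw; split; [| split]; intros HF.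
  + now apply regular_family_solution.
  + now apply singular_family_solution.
  + now apply ultra_singular_family_solution.
Qed.
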